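(* Let $\alpha\ge 0$ and $0<T<1$. The expected value of the maximum likelihood estimator $\hat{\alpha}_{MLE}$ of $\alpha$ based on the observation of the $\alpha$-Brownian bridge $X^{(\alpha)}$ up to time $T$ is $$ \begin{aligned} \mathrm{E}_\alpha[\hat{\alpha}_{MLE}] &= \frac{1}{2} + \frac{(1-T)^{\frac{1-2\alpha}{4}}}{\sqrt{2}} \int_{\frac{1-2\alpha}{2}}^\infty \frac{(1-T)^u-(1-T)^{-u}}{\left(\left(1+\frac{1-2\alpha}{2u}\right)(1-T)^u+\left(1-\frac{1-2\alpha}{2u}\right)(1-T)^{-u}\right)^{3/2}}\,du \\ &\qquad - \frac{\ln(1-T)\,(1-T)^{\frac{1-2\alpha}{4}}}{\sqrt{2}} \int_{\frac{1-2\alpha}{2}}^\infty \frac{u}{\sqrt{\left(1+\frac{1-2\alpha}{2u}\right)(1-T)^u+\left(1-\frac{1-2\alpha}{2u}\right)(1-T)^{-u}}}\,du . \end{aligned} $$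
   Context: Let $W=(W_t)_{t\in[0,1]}$ be a standard Brownian motion. For $\alpha\ge 0$, the $\alpha$-Brownian bridge $X^{(\alpha)}=(X^{(\alpha)}_t)_{t\in[0,1)}$ is the solution of the stochastic differential equation $dX^{(\alpha)}_t=dW_t-\frac{\alpha}{1-t}X^{(\alpha)}_t\,dt$, $X^{(\alpha)}_0=0$, $t\in[0,1)$; explicitly $X^{(\alpha)}_t=\int_0^t\left(\frac{1-t}{1-s}\right)^{\alpha}dW_s$. The maximum likelihood estimator of $\alpha$ based on a trajectory observed until time $T<1$ is $$\hat{\alpha}_{MLE}=-\left(\int_0^T\frac{X^{(\alpha)}_s}{1-s}\,dX^{(\alpha)}_s\right)\Big/\left(\int_0^T\frac{(X^{(\alpha)}_s)^2}{(1-s)^2}\,ds\right),$$ which can equivalently be written as $$\hat{\alpha}_{MLE}=\left(-\frac{(X^{(\alpha)}_T)^2}{1-T}+\int_0^T\frac{(X^{(\alpha)}_s)^2}{(1-s)^2}\,ds-\ln(1-T)\right)\Big/\left(2\int_0^T\frac{(X^{(\alpha)}_s)^2}{(1-s)^2}\,ds\right).$$ $\mathrm{E}_\alpha$ denotes expectation when the true parameter is $\alpha$. *)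

(* Defs.v *)
From HB Require Import structures.
From mathcomp Require Export all_boot all_order all_algebra.
From mathcomp Require Export all_classical all_reals all_analysis.
From mathcomp Require Export measurable_realfun.
Export Order.TTheory GRing.Theory Num.Theory numFieldNormedType.Exports.

Set Implicit Arguments.
Unset Strict Implicit.
Unset Printing Implicit Defensive.

#[global] Open Scope classical_set_scope.
#[global] Open Scope ring_scope.

Section processes.
Context {d : measure_display} {Om : measurableType d} {R : realType}.
Variable P : probability Om R.

(* Taking B i = setT for some of the i gives the product rule on subfamilies. *)
Definition mutually_independent (n : nat) (Y : 'I_n -> {RV P >-> R}) : Prop :=
  forall B : 'I_n -> set R, (forall i, measurable (B i)) ->
    P [set w | forall i, B i (Y i w)] = (\prod_(i < n) P (Y i @^-1` B i))%E.

(* [normal_prob m s] has standard deviation s. *)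
Definition brownian_motion01 (W : R -> {RV P >-> R}) : Prop :=
  [/\ {ae P, forall w, W 0 w = 0},
      {ae P, forall w, {within `[0, 1], continuous (fun t : R => W t w)}},
      (forall s t : R, 0 <= s -> s < t -> t <= 1 ->
         forall B : set R, measurable B ->
           distribution P (W t - W s) B = normal_prob 0 (Num.sqrt (t - s)) B)
    & (forall (n : nat) (t : nat -> R),
         0 <= t 0%N -> t n <= 1 -> (forall i, (i < n)%N -> t i <= t i.+1) ->
         mutually_independent (fun i : 'I_n => W (t i.+1) - W (t i)))].

(* The SDE dX_t = dW_t - alpha / (1 - t) X_t dt, X_0 = 0, on [0, 1[: the noise
   is additive, so its integral form only involves a pathwise integral. *)
Definition alpha_brownian_bridge (alpha : R) (W X : R -> {RV P >-> R}) : Prop :=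
  {ae P, forall w,
    [/\ {within `[0, 1[, continuous (fun t : R => X t w)},
        X 0 w = 0
      & forall t : R, 0 <= t -> t < 1 ->
          X t w = W t w
            - \int[lebesgue_measure]_(s in `[0, t]) (alpha / (1 - s) * X s w)]}.

(* As in [itv_partition] and [variation], the partition of [0, T] is 0 :: s. *)
Definition ito_sum (T : R) (H X : R -> Om -> R) (s : seq R) (w : Om) : R :=
  let t := nth T (0 :: s) in
  \sum_(0 <= i < size s) H (t i) w * (X (t i.+1) w - X (t i) w).

(* I = \int_0^T H_s dX_s in the sense of Ito: limit in probability of the
   left-endpoint sums as the mesh tends to 0. This is the right notion for
   continuous adapted H and continuous semimartingales X only. It determines I
   up to a P-null set. *)
Definition ito_integral (T : R) (H X : R -> Om -> R) (I : {RV P >-> R}) : Prop :=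
  forall e eta : R, 0 < e -> 0 < eta ->
    exists2 delta : R, 0 < delta &
      forall s : seq R, itv_partition 0 T s ->
        (forall i, (i < size s)%N ->
           nth T (0 :: s) i.+1 - nth T (0 :: s) i < delta) ->
        (P [set w | (e <= `|ito_sum T H X s w - I w|)%R] < eta%:E)%E.

Definition alpha_mle (T : R) (X : R -> {RV P >-> R}) (ahat : {RV P >-> R}) :
    Prop :=
  exists2 I : {RV P >-> R}, ito_integral T (fun s w => X s w / (1 - s)) X I &
    {ae P, forall w,
      ahat w = - I w /
        \int[lebesgue_measure]_(s in `[0, T]) ((X s w) ^+ 2 / (1 - s) ^+ 2)}.

End processes.

(* Main.v *)
From HB Require Import structures.
Require Import Defs.
From mathcomp Require Import ring lra.

Set Implicit Arguments.
Unset Strict Implicit.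
Unset Printing Implicit Defensive.

(** Write th = 1 / 2 - alpha and L = - ln (1 - T), and set
      J = \int_0^T X_s ^ 2 / (1 - s) ^ 2 ds,    Q = X_T ^ 2 / (1 - T).
    The Ito formula for X_s ^ 2 / (1 - s) turns the stochastic integral I in
    the estimator into 2 I = Q - J - L, so that the estimator is
      1 / 2 + (L / 2) J^-1 - (1 / 2) Q J^-1                    ([alpha_mleE])
    and its mean is known once E[J^-1] and E[Q J^-1] are. Both come from the
    joint Laplace transform of J and Q ([bridge_laplace]): for u >= |th|,
      E[exp (- (u ^ 2 - th ^ 2) / 2 J - m Q)] = K ^ (- 1 / 2),
    where K = [laplace_sol th u m L]. Since
      J^-1 = \int_|th|^oo u exp (- (u ^ 2 - th ^ 2) / 2 J) du,
    Tonelli's theorem ([inverse_energy_moment]) writes E[J^-1] as the integral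
    of u times the transform at m = 0, and E[Q J^-1] as that of u times minus
    the derivative of the transform in m at m = 0 ([laplace_terminal]). These
    are the two integrals of the statement, over [|th|, oo[ instead of
    [th, oo[; the integrands being odd, the integral over [th, |th|] vanishes
    when th < 0 ([Rintegral_odd_tail]).

    The Laplace transform is obtained without stochastic calculus. In the time
    t = - ln (1 - s), the process exp (t / 2) X is an Ornstein-Uhlenbeck
    process, J is the integral of its square over [0, L] and Q is the square of
    its value at L. On a regular grid in that time, freezing the drift on each
    step gives a Gaussian autoregression, driven by independent increments of W
    rescaled to have the same variance. For this autoregression the Laplace
    transform of a quadratic functional is computed by integrating out one
    innovation at a time, the last one first. The coefficients of the
    functional ([step_cost] and [step_weight]) are tuned so that on every grid
    the result is exactly the continuous-time value ([laplace_ar]). Pathwise,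
    the autoregression is uniformly close to the process ([ar_path_close]), so
    that the functional converges to that of J and Q ([cvg_ar_energy],
    [cvg_ar_terminal]), and dominated convergence concludes.

    The same grids replace the Ito formula. Along them, twice the Ito sums plus
    the sum of the squared innovations telescopes, up to a vanishing error, to
    Q - J ([cvg_ito_energy]), while the sum of the squared innovations tends to
    L in probability, because its Laplace transform tends to that of the
    constant L ([cvg_sumsq_L2]); the limit in probability I of the Ito sums is
    therefore (Q - J - L) / 2 almost surely ([ito_integral_bridge]). *)

(** * Gaussian integrals *)

Section normal_integral.
Context {R : realType}.
Local Notation mu := (@lebesgue_measure R).
Local Open Scope ereal_scope.

Lemma integral_normal_prob (m s : R) (f : R -> \bar R) :
  measurable_fun setT f -> (forall x, 0 <= f x) ->
  \int[normal_prob m s]_x f x = \int[mu]_x (f x * (normal_pdf m s x)%:E).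
Proof.
move=> mf f0.
rewrite -(Radon_Nikodym_SigmaFinite.change_of_variables (normal_prob_dominates m s))//.
apply: ae_eq_integral => //.
- apply: emeasurable_funM => //; apply: (measurable_int mu).
  exact: Radon_Nikodym_SigmaFinite.f_integrable (normal_prob_dominates m s).
- apply: emeasurable_funM => //; apply/measurable_EFinP.
  exact: measurable_normal_pdf.
- apply: ae_eqe_mul2l => /=.
  apply: integral_ae_eq => //.
  + exact: Radon_Nikodym_SigmaFinite.f_integrable (normal_prob_dominates m s).
  + by apply/measurable_EFinP; exact: measurable_normal_pdf.
  + move=> E _ mE; rewrite -(Radon_Nikodym_SigmaFinite.f_integral (normal_prob_dominates m s))//.
Qed.

(** Completing the square: up to a constant factor, the product of the two
    Gaussian functions is again a normal density, of variance s ^ 2 / q with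
    q = 1 + 2 p s ^ 2. *)
Lemma integral_normal_expR_sqr (s p x : R) : (s != 0)%R ->
  (0 < 1 + 2 * p * s ^+ 2)%R ->
  \int[normal_prob 0 s]_z (expR (- (p * (x + z) ^+ 2)))%:E =
  ((Num.sqrt (1 + 2 * p * s ^+ 2))^-1
   * expR (- (p / (1 + 2 * p * s ^+ 2) * x ^+ 2)))%:E.
Proof.
move=> s0; set q := (1 + _)%R => q0.
have sq0 : (0 < Num.sqrt q)%R by rewrite sqrtr_gt0.
have sqE : (Num.sqrt q ^+ 2 = q)%R by rewrite sqr_sqrtr// ltW.
have s'0 : (s / Num.sqrt q != 0)%R by rewrite mulf_neq0// invr_eq0 gt_eqF.
set K := (_ * _)%R.
rewrite integral_normal_prob; last 2 first.
- apply/measurable_EFinP; apply: measurableT_comp => //.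
  apply: measurableT_comp => //; apply: measurable_funM => //.
  by apply: measurable_funX; exact: measurable_funD.
- by move=> z; rewrite lee_fin expR_ge0.
under eq_integral => z _.
  (* the mean and the standard deviation that complete the square *)
  rewrite (_ : _ * _ =
    K%:E * (normal_pdf (- (2 * p * s ^+ 2 * x / q)) (s / Num.sqrt q) z)%:E);
    last first.
    rewrite -!EFinM; congr EFin.
    rewrite !normal_pdfE// /normal_peak /normal_fun /K.
    have -> : ((s / Num.sqrt q) ^+ 2 * pi *+ 2 = (s ^+ 2 * pi *+ 2) / q)%R.
      by rewrite exprMn exprVn sqE mulrAC mulrnAl.
    rewrite sqrtrM; last by rewrite mulrn_wge0// mulr_ge0 ?sqr_ge0 ?pi_ge0.
    rewrite sqrtrV ?ltW// [RHS]mulrACA invfM invrK exprMn exprVn sqE.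
    rewrite (mulrCA _^-1%R _^-1%R (Num.sqrt q)) mulVf ?gt_eqF// mulr1.
    rewrite [LHS]mulrCA; congr (_ * _)%R; rewrite -2!expRD; congr expR.
    by rewrite /q; field; rewrite s0 (lt0r_neq0 q0).
  over.
rewrite integralZl//; last exact: integrable_normal_pdf.
by rewrite integral_normal_pdf mule1.
Qed.

End normal_integral.

Section normal_law.
Context {d : measure_display} {Om : measurableType d} {R : realType}
  (P : probability Om R).
Local Open Scope ereal_scope.

(** [distribution P X] is a measure on [R] while [normal_prob m s] is one on
    [measurableTypeR R], another copy of the Borel sets of the line. The laws
    agree as set functions, but integrals must be carried from one copy to the
    other. *)
Lemma integral_distribution_normal (X : {RV P >-> R}) (m s : R)
    (f : R -> \bar R) :
  (forall B, measurable B -> distribution P X B = normal_prob m s B) ->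
  measurable_fun setT f -> (forall x, 0 <= f x) ->
  \int[distribution P X]_x f x = \int[normal_prob m s]_x f x.
Proof.
move=> lawX mf f0.
have mX : measurable_fun setT (X : Om -> measurableTypeR R).
  exact: (measurable_funPT X).
pose X' : {RV P >-> measurableTypeR R} :=
  HB.pack (X : Om -> measurableTypeR R) (isMeasurableFun.Build _ _ _ _ _ mX).
rewrite ge0_integral_distribution//.
transitivity (\int[distribution P X']_x f x).
  by rewrite ge0_integral_distribution.
by apply: eq_measure_integral => B mB _; exact: lawX.
Qed.

End normal_law.

(** * Recursions driven by independent variables *)

Section product_rule.
Context {d d' : measure_display} {Om : measurableType d} {S : measurableType d'}
  {R : realType} (P : probability Om R).
Local Open Scope ereal_scope.

(** The product rule for rectangles extends to all measurable sets, as in the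
    uniqueness of product measures: both sides are finite measures that agree
    on a pi-system generating the sigma-algebra. The constant [c] stands for
    the probability of an event [E] in the future of [U]. *)
Lemma product_rule_extend (U : Om -> S * R) (E : set Om)
    (c : {nonneg R}) : measurable_fun setT U -> measurable E ->
  (forall A D, measurable A -> measurable D ->
     P (U @^-1` (A `*` D) `&` E) = c%:num%:E * P (U @^-1` (A `*` D))) ->
  forall C, measurable C -> P (U @^-1` C `&` E) = c%:num%:E * P (U @^-1` C).
Proof.
move=> mU mE rect C mC.
(* both sides are measures in C once the measurability of U is supplied *)
pose m1 : {measure set (S * R) -> \bar R} := pushforward (mrestr P mE) U.
pose m2 : {measure set (S * R) -> \bar R} := mscale c (pushforward P U).
suff: m1 mU C = m2 mU C by [].
apply: (@measure_unique _ R _ [set A `*` B | A in measurable & B in measurable]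
  (fun=> setT)) => //.
- by rewrite measurable_prod_measurableType.
- move=> _ _ [A mA [B mB <-]] [A' mA' [B' mB' <-]].
  exists (A `&` A'); first exact: measurableI.
  exists (B `&` B'); first exact: measurableI.
  by rewrite setXI.
- by move=> _; exists setT => //; exists setT => //; rewrite setXTT.
- by rewrite -subTset => x _; exists 0%N.
- by move=> _ [A mA [B mB <-]]; exact: rect.
- move=> _; rewrite /m1 /= /pushforward /mrestr preimage_setT setTI.
  by rewrite (le_lt_trans (probability_le1 P mE)) ?ltry.
Qed.

Variable Z : nat -> {RV P >-> R}.
Variable n : nat.
Hypothesis indep : forall B : nat -> set R, (forall i, measurable (B i)) ->
  P [set w | forall i, (i < n)%N -> B i (Z i w)] =
  \prod_(0 <= i < n) P (Z i @^-1` B i).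

Variables (f : nat -> S * R -> S) (mf : forall k, measurable_fun setT (f k)).
Variable v0 : S.

(** A state updated from fresh independent inputs. Keeping the state type
    abstract lets a pair record a process together with a running sum. *)
Fixpoint chain k w : S :=
  if k is j.+1 then f j (chain j w, Z j w) else v0.

Lemma measurable_chain k : measurable_fun setT (chain k).
Proof.
elim: k => [|k ih] /=; first exact: measurable_cst.
by apply: measurableT_comp => //; exact: measurable_fun_pair.
Qed.

Let future k (B : nat -> set R) :=
  [set w | forall i, (k <= i < n)%N -> B i (Z i w)].

Let measurable_future k B : (forall i, measurable (B i)) ->
  measurable (future k B).
Proof.
move=> mB; have -> : future k B =
    \bigcap_i (if (k <= i < n)%N then Z i @^-1` B i else setT).
  apply/seteqP; split => w /= h i; first by case: ifPn => // ki _; exact: h.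
  by move=> ki; have := h i I; rewrite ki.
apply: bigcap_measurableType => i _; case: ifPn => // _.
exact: measurable_funPTI.
Qed.

Let futureS k B : (k < n)%N -> future k B = Z k @^-1` B k `&` future k.+1 B.
Proof.
move=> kn; apply/seteqP; split => w /=.
  move=> h; split; first by apply: h; rewrite leqnn.
  by move=> i /andP[ki ii]; apply: h; rewrite (ltnW ki).
move=> [h1 h2] i; rewrite leq_eqVlt => /andP[/orP[/eqP <- //|ki] ii].
by apply: h2; rewrite ki.
Qed.

(** The state after k steps is independent of the inputs from the k-th on. The
    induction needs all future inputs at once, since each step moves one of
    them from the future into the state. *)
Let chain_future k A B : (k <= n)%N -> measurable A ->
  (forall i, measurable (B i)) ->
  P (chain k @^-1` A `&` future k B) =
  P (chain k @^-1` A) * \prod_(k <= i < n) P (Z i @^-1` B i).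
Proof.
elim: k A B => [|k ih] A B kn mA mB.
  have -> : future 0 B = [set w | forall i, (i < n)%N -> B i (Z i w)] by [].
  rewrite /= preimage_cst; case: ifPn => _.
    by rewrite setTI indep// probability_setT mul1e.
  by rewrite set0I measure0 mul0e.
pose U w := (chain k w, Z k w).
have mU : measurable_fun setT U.
  by apply: measurable_fun_pair => //; exact: measurable_chain.
have -> : chain k.+1 @^-1` A = U @^-1` (f k @^-1` A) by [].
set c := \prod_(_ <= _ < _) _.
have c0 : 0 <= c by apply: prode_ge0.
have cfin : c \is a fin_num.
  apply: prode_fin_num => i _; apply: fin_num_measure.
  exact: measurable_funPTI.
have mfA : measurable (f k @^-1` A).
  by rewrite -[X in measurable X]setTI; exact: mf.
rewrite muleC -(fineK cfin).
have fc0 : (0 <= fine c)%R by exact: fine_ge0.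
apply: (@product_rule_extend U (future k.+1 B) (NngNum fc0)) => //.
  exact: measurable_future.
move=> {mfA mA}{}A D mA mD /=; rewrite fineK//.
(* the event on the k-th input is moved back into the future *)
pose upd (B : nat -> set R) i := if i == k then D else B i.
have mupd B' : (forall i, measurable (B' i)) -> forall i, measurable (upd B' i).
  by move=> mB' i; rewrite /upd; case: ifP.
have updk B' : upd B' k = D by rewrite /upd eqxx.
have updE B' i : (k < i)%N -> upd B' i = B' i by rewrite /upd => /gtn_eqF ->.
have futupd B' : future k.+1 (upd B') = future k.+1 B'.
  by apply/seteqP; split => w /= h i /[dup] ki /h; rewrite updE//;
    case/andP: ki.
have UE B' : U @^-1` (A `*` D) `&` future k.+1 B' =
    chain k @^-1` A `&` future k (upd B').
  by rewrite (futureS _ kn) updk futupd setIA.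
have key B' : (forall i, measurable (B' i)) ->
    P (U @^-1` (A `*` D) `&` future k.+1 B') =
    P (chain k @^-1` A) * P (Z k @^-1` D) *
    \prod_(k.+1 <= i < n) P (Z i @^-1` B' i).
  move=> mB'; rewrite UE ih//; [|exact: ltnW|exact: mupd].
  rewrite big_ltn// updk muleA; congr (_ * _).
  by apply: eq_big_nat => i /andP[ki _]; rewrite updE.
rewrite key// -/c muleC; congr (_ * _).
have := key (fun=> setT) (fun=> measurableT).
rewrite big1 ?mule1; last by move=> i _; rewrite preimage_setT probability_setT.
by move=> <-; congr (P _); rewrite -[RHS]setIT; congr (_ `&` _); apply/seteqP; split.
Qed.

Lemma chain_indep k A D : (k < n)%N -> measurable A -> measurable D ->
  P (chain k @^-1` A `&` Z k @^-1` D) = P (chain k @^-1` A) * P (Z k @^-1` D).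
Proof.
move=> kn mA mD.
have := @chain_future k A (fun i => if i == k then D else setT) (ltnW kn) mA.
have futT : future k.+1 (fun i => if i == k then D else setT) = setT.
  by apply/seteqP; split => // w _ i /andP[/gtn_eqF -> _].
rewrite (futureS _ kn) futT setIT eqxx.
move=> ->; last by move=> i; case: ifP.
rewrite big_ltn// eqxx big_nat_cond big1 ?mule1// => i /andP[/andP[ki _] _].
by rewrite gtn_eqF// preimage_setT probability_setT.
Qed.

(** Conditioning on the state: the next input is integrated out first, the
    state being held fixed. *)
Lemma integral_chain (phi : S * R -> \bar R) k : (k < n)%N ->
  measurable_fun setT phi -> (forall x, 0 <= phi x) ->
  \int[P]_w phi (chain k w, Z k w) =
  \int[P]_w \int[distribution P (Z k)]_z phi (chain k w, z).
Proof.
move=> kn mphi phi0.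
pose U w := (chain k w, Z k w).
have mU : measurable_fun setT U.
  by apply: measurable_fun_pair => //; exact: measurable_chain.
pose rvU : {RV P >-> (S * R)%type} :=
  HB.pack U (isMeasurableFun.Build _ _ _ _ _ mU).
pose rvC : {RV P >-> S} :=
  HB.pack (chain k) (isMeasurableFun.Build _ _ _ _ _ (measurable_chain k)).
transitivity (\int[distribution P rvU]_x phi x).
  by rewrite ge0_integral_distribution.
transitivity (\int[distribution P rvC \x distribution P (Z k)]_x phi x).
  apply: eq_measure_integral => C mC _; apply/esym.
  apply: product_measure_unique => // A D mA mD.
  exact: chain_indep.
rewrite fubini_tonelli1// ge0_integral_distribution//.
  exact: measurable_fun_fubini_tonelli_F.
by move=> y; apply: integral_ge0.
Qed.

End product_rule.

(** * Quadratic functionals of a Gaussian autoregression *)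

Section riccati.
Context {R : realType}.
Implicit Types th u mu dl sg : R.

(** The solution of K'' = 2 th K' + (u ^ 2 - th ^ 2) K with K 0 = 1 and
    K' 0 = 2 mu. It linearizes the Riccati equation met when the Laplace
    transform of an Ornstein-Uhlenbeck functional is computed backwards in
    time; [sg] is the remaining time. *)
Definition laplace_sol th u mu sg : R :=
  ((1 + (2 * mu - th) / u) * expR ((u + th) * sg)
   + (1 - (2 * mu - th) / u) * expR ((th - u) * sg)) / 2.

(** The common variance of the rescaled Brownian increments on a grid of step
    [dl]. *)
Definition step_var dl : R := 1 - expR (- dl).

(** The cost of the square of the state in one step of length [dl]. It is
    equivalent to (u ^ 2 - th ^ 2) / 2 * dl as [dl] tends to 0; the exact form
    is the one that makes [step_weightS] an identity. *)
Definition step_cost th u dl : R :=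
  expR (- ((th + u) * dl)) * (expR ((u - th) * dl) - 1)
  * (expR ((u + th) * dl) - 1) / (2 * step_var dl).

(** The weight of the square of the state when the time [sg] remains. It is
    defined by what is asked of it in [step_weight_var]: that the Gaussian
    integration of one step multiplies the transform by the ratio of two values
    of [laplace_sol] to the power - 1 / 2. It tends to mu for [sg] = 0. *)
Definition step_weight th u mu dl sg : R :=
  (laplace_sol th u mu (sg + dl) / laplace_sol th u mu sg - 1)
  / (2 * expR (2 * th * dl) * step_var dl).

Lemma step_var_gt0 dl : 0 < dl -> 0 < step_var dl.
Proof. by move=> dl0; rewrite subr_gt0 -expR0 ltr_expR oppr_lt0. Qed.

Lemma step_cost_ge0 th u dl : `|th| <= u -> 0 < dl -> 0 <= step_cost th u dl.
Proof.
rewrite ler_norml => /andP[thu1 thu2] dl0.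
have h1 : 0 <= expR ((u - th) * dl) - 1.
  by rewrite subr_ge0 -expR0 ler_expR mulr_ge0 ?subr_ge0// ltW.
have h2 : 0 <= expR ((u + th) * dl) - 1.
  by rewrite subr_ge0 -expR0 ler_expR mulr_ge0 ?(ltW dl0)//; lra.
apply: divr_ge0; last by rewrite mulr_ge0// ltW// step_var_gt0.
by apply: mulr_ge0 => //; apply: mulr_ge0 => //; exact: expR_ge0.
Qed.

(** By exp x >= 1 + x applied to the two exponentials, whose coefficients are
    nonnegative up to the term in mu; the terms in u ^ 2 - th ^ 2 cancel. *)
Lemma laplace_sol_ge1 th u mu sg : `|th| <= u -> 0 < u -> 0 <= mu -> 0 <= sg ->
  1 <= laplace_sol th u mu sg.
Proof.
rewrite ler_norml => /andP[thu1 thu2] u0 mu0 sg0; rewrite /laplace_sol.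
have := expR_ge1Dx ((u + th) * sg); have := expR_ge1Dx ((th - u) * sg).
have : expR ((th - u) * sg) <= expR ((u + th) * sg).
  by rewrite ler_expR ler_wpM2r//; lra.
set e1 := expR ((u + th) * sg); set e2 := expR _ => e21 e2_ge e1_ge.
rewrite ler_pdivlMr// mul1r.
have -> : (1 + (2 * mu - th) / u) * e1 + (1 - (2 * mu - th) / u) * e2 =
  ((u - th) * e1 + (u + th) * e2 + 2 * mu * (e1 - e2)) / u.
  by field; rewrite gt_eqF.
rewrite ler_pdivlMr//.
have h1 : (u - th) * (1 + (u + th) * sg) <= (u - th) * e1.
  by rewrite ler_wpM2l// subr_ge0.
have h2 : (u + th) * (1 + (th - u) * sg) <= (u + th) * e2.
  by rewrite ler_wpM2l//; lra.
have h3 : 0 <= 2 * mu * (e1 - e2) by rewrite !mulr_ge0// subr_ge0.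
apply: le_trans (lerD (lerD h1 h2) h3).
by rewrite le_eqVlt; apply/orP; left; apply/eqP; ring.
Qed.

Lemma laplace_sol_gt0 th u mu sg : `|th| <= u -> 0 < u -> 0 <= mu -> 0 <= sg ->
  0 < laplace_sol th u mu sg.
Proof. by move=> *; apply: (lt_le_trans ltr01); exact: laplace_sol_ge1. Qed.

Lemma step_weight_var th u mu dl sg : 0 < dl ->
  1 + 2 * (step_weight th u mu dl sg * expR (2 * th * dl)) * step_var dl =
  laplace_sol th u mu (sg + dl) / laplace_sol th u mu sg.
Proof.
move=> dl0; rewrite /step_weight; set r := (laplace_sol _ _ _ _ / _).
have := lt0r_neq0 (step_var_gt0 dl0); have := expR_gt0 (2 * th * dl) => /lt0r_neq0.
by move=> h1 h2; field; rewrite h1 h2.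
Qed.

(** The discrete Riccati equation. A weight p on the state becomes
    p / (1 + 2 p v) when an innovation of variance v is integrated out, to
    which the cost of the step is added; the weights form an orbit of this
    map. *)
Lemma step_weightS th u mu dl sg : `|th| <= u -> 0 < u -> 0 <= mu -> 0 < dl ->
  0 <= sg ->
  step_cost th u dl
  + step_weight th u mu dl sg * expR (2 * th * dl)
    / (laplace_sol th u mu (sg + dl) / laplace_sol th u mu sg) =
  step_weight th u mu dl (sg + dl).
Proof.
move=> thu u0 mu0 dl0 sg0.
have y0 := laplace_sol_gt0 thu u0 mu0 sg0.
have sg1 : 0 <= sg + dl by rewrite addr_ge0// ltW.
have y1 := laplace_sol_gt0 thu u0 mu0 sg1.
have v0 := step_var_gt0 dl0.
move: y0 y1 v0; rewrite /step_weight /step_cost.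
move: (step_var dl) => v.
have -> : expR (2 * th * dl) = expR ((u + th) * dl) * expR ((th - u) * dl).
  by rewrite -expRD; congr expR; ring.
have -> : expR (- ((th + u) * dl)) = (expR ((u + th) * dl))^-1.
  by rewrite expRN (addrC th).
have -> : expR ((u - th) * dl) = (expR ((th - u) * dl))^-1.
  by rewrite -expRN; congr expR; ring.
rewrite /laplace_sol !mulrDr !expRD.
have := expR_gt0 ((u + th) * dl); have := expR_gt0 ((th - u) * dl).
set a := expR ((u + th) * dl); set b := expR ((th - u) * dl).
set A := expR ((u + th) * sg); set B := expR ((th - u) * sg).
move=> b0 a0 y0 y1 v0.
set c := 1 + _ in y0 y1 *; set d := 1 - _ in y0 y1 *.
have {}y0 : c * A + d * B != 0.
  by apply: contraTneq y0 => ->; rewrite mul0r ltxx.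
have {}y1 : c * (A * a) + d * (B * b) != 0.
  by apply: contraTneq y1 => ->; rewrite mul0r ltxx.
field.
by rewrite y0 y1 !lt0r_neq0.
Qed.

End riccati.

Section gaussian_chain.
Context {d : measure_display} {Om : measurableType d} {R : realType}
  (P : probability Om R).
Variables (Z : nat -> {RV P >-> R}) (n : nat) (c sd : nat -> R) (v : R).
Hypotheses (v0 : 0 < v) (c0 : forall k, 0 < c k)
  (csd : forall k, (c k * sd k) ^+ 2 = v).
Hypothesis indep : forall B : nat -> set R, (forall i, measurable (B i)) ->
  (P [set w | forall i, (i < n)%N -> B i (Z i w)] =
   \prod_(0 <= i < n) P (Z i @^-1` B i))%E.
Hypothesis law : forall k, (k < n)%N -> forall B, measurable B ->
  distribution P (Z k) B = normal_prob 0 (sd k) B.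
Local Open Scope ereal_scope.

(** One step of the backward recursion: the k-th innovation, of variance v, is
    independent of the state and is integrated out, which lowers the weight p
    to p / (1 + 2 p v). *)
Lemma integral_chain_sqr d' (S : measurableType d') (f : nat -> S * R -> S)
    (i0 : S) (g h : S -> R) (p : R) k :
  (forall i, measurable_fun setT (f i)) ->
  measurable_fun setT g -> measurable_fun setT h -> (k < n)%N ->
  (0 < 1 + 2 * p * v)%R ->
  let C := chain Z f i0 k in
  \int[P]_w (expR (g (C w) - p * (h (C w) + c k * Z k w) ^+ 2))%:E =
  (Num.sqrt (1 + 2 * p * v))^-1%:E *
  \int[P]_w (expR (g (C w) - p / (1 + 2 * p * v) * h (C w) ^+ 2))%:E.
Proof.
move=> mf mg mh kn q0 C.
have ck0 : c k != 0%R by rewrite gt_eqF.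
have sd0 : sd k != 0%R.
  by apply: contraTneq v0 => sd0; rewrite -(csd k) sd0 mulr0 expr0n ltxx.
have pE : (1 + 2 * (p * c k ^+ 2) * sd k ^+ 2 = 1 + 2 * p * v)%R.
  by rewrite -(csd k); ring.
have mC : measurable_fun setT C by exact: measurable_chain.
pose phi (x : S * R) := (expR (g x.1 - p * (h x.1 + c k * x.2) ^+ 2))%:E.
have mphi : measurable_fun setT phi.
  apply/measurable_EFinP; apply: measurableT_comp => //.
  apply: measurable_funB; first exact: measurableT_comp.
  apply: measurable_funM => //; apply: measurable_funX.
  by apply: measurable_funD; [exact: measurableT_comp|exact: measurable_funM].
transitivity (\int[P]_w phi (C w, Z k w)) => //.
rewrite (integral_chain indep)//; last by move=> x; rewrite lee_fin expR_ge0.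
rewrite -ge0_integralZl//; last first.
  apply/measurable_EFinP; apply: measurableT_comp => //.
  apply: measurable_funB; first exact: measurableT_comp.
  apply: measurable_funM => //; apply: measurable_funX.
  exact: measurableT_comp.
apply: eq_integral => w _; rewrite -/C.
rewrite (integral_distribution_normal (law kn)); last 2 first.
- by apply: measurableT_comp => //; exact: measurable_pair1.
- by move=> x; rewrite lee_fin expR_ge0.
have phiE z : phi (C w, z) = (expR (g (C w)))%:E *
    (expR (- (p * c k ^+ 2 * (h (C w) / c k + z) ^+ 2)))%:E.
  by rewrite /phi /= -EFinM -expRD; congr (expR _)%:E; field.
under eq_integral do rewrite phiE.
rewrite ge0_integralZl//; last first.
  apply/measurable_EFinP; apply: measurableT_comp => //.
  apply: measurableT_comp => //; apply: measurable_funM => //.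
  by apply: measurable_funX; exact: measurable_funD.
rewrite integral_normal_expR_sqr// ?pE// -!EFinM; congr EFin.
rewrite mulrCA -expRD; congr (_ * expR (_ + _))%R.
by congr (- _)%R; field; rewrite ck0 gt_eqF.
Qed.

Definition sqr_step (k : nat) (x : R * R) : R := (x.1 + (c k * x.2) ^+ 2)%R.

(** A sum of k independent squared Gaussian variables of variance v: the
    Laplace transform of a Gamma law. *)
Lemma laplace_sum_sqr s k : (0 <= s)%R -> (k <= n)%N ->
  \int[P]_w (expR (- (s * chain Z sqr_step 0%R k w)))%:E =
  ((Num.sqrt (1 + 2 * s * v))^-1 ^+ k)%:E.
Proof.
move=> s0; elim: k => [|k ih] kn.
  under eq_integral do rewrite /= mulr0 oppr0 expR0.
  by rewrite integral_cst//= probability_setT mule1 expr0.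
have q0 : (0 < 1 + 2 * s * v)%R.
  by rewrite ltr_wpDr// mulr_ge0 ?mulr_ge0 ?(ltW v0).
have mS i : measurable_fun setT (sqr_step i).
  by apply: measurable_funD => //; apply: measurable_funX; exact: measurable_funM.
pose C := chain Z sqr_step 0%R k.
transitivity (\int[P]_w (expR (- (s * C w) - s * (0 + c k * Z k w) ^+ 2))%:E).
  by apply: eq_integral => w _; rewrite add0r -opprD -mulrDr.
rewrite (@integral_chain_sqr _ _ _ _ (fun a => - (s * a))%R (fun=> 0%R))//;
  last by apply: measurableT_comp => //; exact: measurable_funM.
under eq_integral do rewrite expr0n /= mulr0 subr0.
by rewrite (ih (ltnW kn)) [in RHS]exprS EFinM.
Qed.

Variables (th u mu dl : R).
Hypotheses (thu : (`|th| <= u)%R) (u0 : (0 < u)%R) (mu0 : (0 <= mu)%R)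
  (dl0 : (0 < dl)%R) (vE : v = step_var dl).

(** The state is the autoregression together with its accumulated cost. *)
Definition ar_step (k : nat) (x : R * R * R) : R * R :=
  (x.1.1 + step_cost th u dl * x.1.2 ^+ 2, expR (th * dl) * (x.1.2 + c k * x.2))%R.

Lemma measurable_ar_step i : measurable_fun setT (ar_step i).
Proof.
apply: measurable_fun_pair.
  apply: measurable_funD; first exact: measurableT_comp.
  by apply: measurable_funM => //; apply: measurable_funX; exact: measurableT_comp.
apply: measurable_funM => //; apply: measurable_funD.
  exact: measurableT_comp.
exact: measurable_funM.
Qed.

(** The induction on the number of steps integrates out the last innovation and
    lets [sg], the time already accounted for in the weight, grow by one step.
    The factors of the steps are ratios of values of [laplace_sol], so that
    their product telescopes. *)
Lemma laplace_ar k sg : (k <= n)%N -> (0 <= sg)%R ->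
  let C := chain Z ar_step (0, 0)%R k in
  \int[P]_w (expR (- (C w).1 - step_weight th u mu dl sg * (C w).2 ^+ 2))%:E =
  (Num.sqrt (laplace_sol th u mu sg / laplace_sol th u mu (sg + k%:R * dl)))%:E.
Proof.
elim: k sg => [|k ih] sg kn sg0 C.
  rewrite mul0r addr0 divff ?gt_eqF ?laplace_sol_gt0// sqrtr1.
  under eq_integral do rewrite /C /= oppr0 expr0n /= mulr0 subr0 expR0.
  by rewrite integral_cst//= probability_setT mule1.
have sg1 : (0 <= sg + dl)%R by rewrite addr_ge0// ltW.
have y0 := laplace_sol_gt0 thu u0 mu0 sg0.
have y1 := laplace_sol_gt0 thu u0 mu0 sg1.
set p := (step_weight th u mu dl sg * expR (2 * th * dl))%R.
have q0 : (0 < 1 + 2 * p * v)%R by rewrite vE step_weight_var// divr_gt0.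
have pE : (p / (1 + 2 * p * v) = step_weight th u mu dl (sg + dl)
    - step_cost th u dl)%R.
  by rewrite -(step_weightS thu u0 mu0 dl0 sg0) vE step_weight_var// [RHS]addrAC subrr add0r.
pose D := chain Z ar_step (0, 0)%R k.
transitivity (\int[P]_w (expR ((- (D w).1 - step_cost th u dl * (D w).2 ^+ 2)
    - p * ((D w).2 + c k * Z k w) ^+ 2))%:E).
  apply: eq_integral => w _; congr (expR _)%:E; rewrite /C /= -/D /p.
  have -> : (expR (2 * th * dl) = expR (th * dl) ^+ 2)%R.
    by rewrite -expRM_natl mulrA.
  by ring.
rewrite (@integral_chain_sqr _ _ _ _
  (fun x : R * R => - x.1 - step_cost th u dl * x.2 ^+ 2)%R snd)//;
  last 2 first.
- exact: measurable_ar_step.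
- apply: measurable_funB; first exact: measurableT_comp.
  by apply: measurable_funM => //; exact: measurable_funX.
rewrite pE vE step_weight_var//.
under eq_integral => w _ do
  rewrite -addrA -opprD -mulrDl (addrC (step_cost _ _ _)) subrK.
rewrite (ih _ (ltnW kn) sg1) -EFinM; congr EFin.
have r0 : (0 <= laplace_sol th u mu (sg + dl) / laplace_sol th u mu sg)%R.
  by rewrite divr_ge0 ?ltW.
rewrite -(sqrtrV r0) -sqrtrM; last by rewrite invr_ge0.
congr (Num.sqrt _); rewrite invf_div mulrA divfK ?gt_eqF//.
by congr (_ / laplace_sol _ _ _ _)%R; rewrite -addrA [in RHS]mulr_natl mulrS mulr_natl.
Qed.

End gaussian_chain.

(** * Uniform continuity and the weight 1 / (1 - s) *)

Section uniform_continuity.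
Context {R : realType}.

(** The closed inequality on the distance, with the bound d ranging over a
    right neighbourhood of 0, is what the covering form of compactness gives
    directly. *)
Lemma segment_unif_continuous (f : R -> R) (a b : R) :
  {within `[a, b], continuous f} ->
  forall e, 0 < e -> \forall d \near 0^'+, forall s t, s \in `[a, b] ->
    t \in `[a, b] -> `|s - t| <= d -> `|f s - f t| < e.
Proof.
move=> cf e e0.
have /compact_near_coveringP/(_ R 0^'+
  (fun d s => s \in `[a, b] -> forall t, t \in `[a, b] ->
    `|s - t| <= d -> `|f s - f t| < e)) := @segment_compact _ a b.
have FF : Filter (0 : R)^'+ by exact: at_right_proper_filter.
move=> /(_ FF) H.
have {}H := H _.
suff /H : forall x, `[a, b]%classic x -> \forall x' \near x & i \near 0^'+,
    x' \in `[a, b] -> forall t, t \in `[a, b] ->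
    `|x' - t| <= i -> `|f x' - f t| < e.
  by apply: filterS => d h s t sab tab; apply: h.
move=> x xab.
move/subspace_continuousP : cf => /(_ x xab)/cvgrPdist_lt/(_ (e / 2)).
rewrite divr_gt0// => /(_ isT).
rewrite nearE /within /= => -[/= r r0 fr].
near=> s d => sab t tab std.
have sx : `|x - s| < r / 2.
  by near: s; apply: nbhsx_ballx; rewrite divr_gt0.
have dr : d < r / 2 by near: d; apply: nbhs_right_lt; rewrite divr_gt0.
have /fr/(_ sab) fs : ball x r s.
  by rewrite /ball /= (lt_trans sx)// ltr_pdivrMr// ltr_pMr// ltr1n.
have /fr/(_ tab) ft : ball x r t.
  rewrite /ball /= (splitr r) -(subrKA s) (le_lt_trans (ler_normD _ _))// ltrD//.
  exact: le_lt_trans dr.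
rewrite (splitr e) -(subrKA (f x)) (le_lt_trans (ler_normD _ _))// ltrD//.
by rewrite distrC.
Unshelve. all: by end_near.
Qed.

(** The bound on the oscillation at scale K / (n + 1) is the supremum of the
    oscillations, which is finite by compactness; its convergence to 0 is
    uniform continuity. *)
Lemma continuity_modulus (f : R -> R) (a b K : R) :
  {within `[a, b], continuous f} ->
  exists2 w : nat -> R, w n @[n --> \oo] --> 0 &
    forall n s t, s \in `[a, b] -> t \in `[a, b] ->
      `|s - t| <= K / n.+1%:R -> `|f s - f t| <= w n.
Proof.
move=> cf; have [ab|ba] := leP a b; last first.
  exists (fun=> 0); first exact: cvg_cst.
  by move=> n s t; rewrite in_itv /= => /andP[/le_trans h /h]; rewrite leNgt ba.
have /compact_bounded[M [_ Mf]] : compact (f @` `[a, b]).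
  exact: continuous_compact (@segment_compact _ a b).
have f_le s : s \in `[a, b] -> `|f s| <= M + 1.
  by move=> sab; apply: (Mf (M + 1)); [rewrite ltrDl|exists s].
pose V n := [set `|f x.1 - f x.2| | x in [set x : R * R |
  [/\ x.1 \in `[a, b], x.2 \in `[a, b] & `|x.1 - x.2| <= K / n.+1%:R]]].
have V_ub n : has_ubound (V n).
  exists ((M + 1) + (M + 1)) => _ [[s t] /= [sab tab _] <-].
  by rewrite (le_trans (ler_normB _ _))// lerD// f_le.
have V_le n s t : s \in `[a, b] -> t \in `[a, b] ->
    `|s - t| <= K / n.+1%:R -> `|f s - f t| <= sup (V n).
  by move=> sab tab st; apply: ub_le_sup => //; exists (s, t).
exists (fun n => sup (V n)) => //.
have [K0|K0] := ltP K 0.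
  have V0 n : V n = set0.
    apply/seteqP; split => // _ [[s t] /= [_ _ st] _].
    have := le_trans (normr_ge0 _) st.
    by rewrite leNgt pmulr_llt0 ?invr_gt0 ?ltr0n// K0.
  by under eq_cvg do rewrite V0 sup0; exact: cvg_cst.
apply/cvgrPdist_le => e e0.
have : (K / n.+1%:R) @[n --> \oo] --> 0.
  rewrite -(mulr0 K); apply: cvgMr; exact: cvg_harmonic.
move=> /cvgrPdist_le Kn.
have [d /= d0 fd] := segment_unif_continuous cf e0.
have := Kn (d / 2); rewrite divr_gt0// => /(_ isT).
apply: filterS => n; rewrite sub0r normrN => dn.
rewrite sub0r normrN ger0_norm; last first.
  by apply: le_trans (V_le n a a _ _ _); rewrite ?subrr ?normr0 ?bound_itvE//;
    rewrite divr_ge0.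
apply: ge_sup.
  exists `|f a - f a|, (a, a) => //=; split; rewrite ?bound_itvE//.
  by rewrite subrr normr0 divr_ge0.
move=> _ [[s t] /= [sab tab st] <-]; apply/ltW.
apply: (fd (d / 2)) => //=; last 2 first.
- by rewrite divr_gt0.
- by rewrite (le_trans st)// (le_trans (ler_norm _)).
- by rewrite /ball /= sub0r normrN ger0_norm ?divr_ge0 ?ltW// ltr_pdivrMr// ltr_pMr// ltr1n.
Qed.

End uniform_continuity.

Section log_time.
Context {R : realType}.
Local Notation mu := (@lebesgue_measure R).

Lemma continuous_oneminus_inv (s : R) : s < 1 ->
  {for s, continuous (fun s : R => (1 - s)^-1)}.
Proof.
move=> s1; apply: cvgV; first by rewrite gt_eqF// subr_gt0.
by apply: cvgB; [exact: cvg_cst|exact: cvg_id].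
Qed.

Lemma within_continuous_oneminus_inv (p q : R) : q < 1 ->
  {within `[p, q], continuous (fun s : R => (1 - s)^-1)}.
Proof.
move=> q1; apply: continuous_in_subspaceT => s /[!inE] /=.
rewrite in_itv /= => /andP[_ sq].
by apply: continuous_oneminus_inv; exact: le_lt_trans q1.
Qed.

Lemma within_continuousM (A : set R) (f g : R -> R) :
  {within A, continuous f} -> {within A, continuous g} ->
  {within A, continuous (fun s => f s * g s)}.
Proof. by move=> cf cg s; apply: cvgM; [exact: cf|exact: cg]. Qed.

Lemma integrable_segment (f : R -> R) (p q : R) :
  {within `[p, q], continuous f} -> mu.-integrable `[p, q] (EFin \o f).
Proof. exact/continuous_compact_integrable/segment_compact. Qed.

Lemma Rintegral_oneminus_inv (p q : R) : p <= q -> q < 1 ->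
  \int[mu]_(s in `[p, q]) (1 - s)^-1 = ln (1 - p) - ln (1 - q).
Proof.
rewrite le_eqVlt => /predU1P[<- _|pq q1].
  by rewrite set_itv1 Rintegral_set1 subrr.
pose F (s : R) := - ln (1 - s).
have dF : forall s : R, s < 1 -> is_derive s 1 F (1 - s)^-1.
  move=> s s1; have s10 : 0 < 1 - s by rewrite subr_gt0.
  have d1 : is_derive s 1 (fun s : R => 1 - s) (0 - 1).
    by apply: is_deriveB.
  have d2 : is_derive (1 - s) 1 (@ln R) (1 - s)^-1 by exact: is_derive1_ln.
  have := is_deriveN (@is_derive1_comp _ (@ln R) (fun s : R => 1 - s) s _ _ d2 d1).
  by rewrite sub0r mulrN1 opprK.
have cF : forall s : R, s < 1 -> {for s, continuous F}.
  by move=> s /dF[] dFs _; apply/differentiable_continuous/derivable1_diffP.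
rewrite /Rintegral (continuous_FTC2 (F := F) pq).
- by rewrite -EFinB /= /F opprK addrC.
- exact: within_continuous_oneminus_inv.
- split.
  + by move=> s /[!in_itv] /= /andP[_ sq]; have [] := dF s (lt_trans sq q1).
  + by apply: cvg_at_right_filter; apply: cF; exact: lt_trans q1.
  + by apply: cvg_at_left_filter; exact: cF.
- move=> s /[!in_itv] /= /andP[_ sq]; rewrite derive1E.
  by have [_ ->] := dF s (lt_trans sq q1).
Qed.

Lemma Rintegral_segment_split (f : R -> R) (a p q : R) : a <= p -> p <= q ->
  {within `[a, q], continuous f} ->
  \int[mu]_(s in `[a, q]) f s =
  \int[mu]_(s in `[a, p]) f s + \int[mu]_(s in `[p, q]) f s.
Proof.
move=> ap pq cf.
have intf := integrable_segment cf.
have := @Rintegral_itvB R f (BLeft a) (BRight q) p intf.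
rewrite !bnd_simp => /(_ ap pq).
rewrite Rintegral_itv_obnd_cbnd; last first.
  by apply: integrableS intf => //; apply: subset_itvr; rewrite bnd_simp.
by move=> <-; rewrite addrC subrK.
Qed.

(** The measure ds / (1 - s) is the length in logarithmic time; freezing the
    integrand on a grid cell costs its oscillation times that length. *)
Lemma Rintegral_oneminus_approx (g : R -> R) (p q c w : R) :
  p <= q -> q < 1 -> {within `[p, q], continuous g} ->
  (forall s, s \in `[p, q] -> `|g s - c| <= w) ->
  `|\int[mu]_(s in `[p, q]) (g s * (1 - s)^-1) - c * (ln (1 - p) - ln (1 - q))|
  <= w * (ln (1 - p) - ln (1 - q)).
Proof.
move=> pq q1 cg gcw.
have ci := @within_continuous_oneminus_inv p q q1.
have ii := integrable_segment ci.
have cc (k : R) : {within `[p, q], continuous (fun s : R => k * (1 - s)^-1)}.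
  by apply: within_continuousM => //; apply: continuous_subspaceT => ?; exact: cvg_cst.
have cgi : {within `[p, q], continuous (fun s : R => g s * (1 - s)^-1)}.
  exact: within_continuousM.
have cd : {within `[p, q], continuous (fun s : R => g s * (1 - s)^-1 - c * (1 - s)^-1)}.
  by move=> s; apply: cvgB; [exact: cgi|exact: cc].
rewrite -Rintegral_oneminus_inv// -!RintegralZl// -RintegralB//; last 2 first.
- exact: integrable_segment.
- exact: integrable_segment.
apply: le_trans (le_normr_Rintegral _ _) _ => //; first exact: integrable_segment.
apply: le_Rintegral => //.
- by apply: integrable_segment => s; apply: cvg_norm; exact: cd.
- exact: integrable_segment.
- move=> s spq; rewrite -mulrBl normrM ler_pM//; first exact: gcw.
  rewrite ger0_norm// invr_ge0 subr_ge0 ltW//.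
  by move: spq; rewrite /= in_itv /= => /andP[_ /le_lt_trans]; apply.
Qed.

End log_time.

(** * The bridge on grids that are regular in logarithmic time *)

Section grid.
Context {R : realType}.
Implicit Types dl : R.

(** The points at logarithmic times k dl, where - ln (1 - s) is the logarithmic
    time of s. *)
Definition grid dl (k : nat) : R := 1 - expR (- (k%:R * dl)).

Lemma oneminus_grid dl k : 1 - grid dl k = expR (- (k%:R * dl)).
Proof. by rewrite /grid opprB addrC subrK. Qed.

Lemma grid0 dl : grid dl 0 = 0.
Proof. by rewrite /grid mul0r oppr0 expR0 subrr. Qed.

Lemma grid_lt1 dl k : grid dl k < 1.
Proof. by rewrite -subr_gt0 oneminus_grid expR_gt0. Qed.

Lemma ler_grid dl j k : 0 <= dl -> (j <= k)%N -> grid dl j <= grid dl k.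
Proof.
by move=> dl0 jk; rewrite lerD2l lerN2 ler_expR lerN2 ler_wpM2r// ler_nat.
Qed.

Lemma ltr_grid dl j k : 0 < dl -> (j < k)%N -> grid dl j < grid dl k.
Proof.
by move=> dl0 jk; rewrite ltrD2l ltrN2 ltr_expR ltrN2 ltr_pM2r// ltr_nat.
Qed.

Lemma ln_gridS dl k : ln (1 - grid dl k) - ln (1 - grid dl k.+1) = dl.
Proof. by rewrite !oneminus_grid !expRK opprK -natr1; ring. Qed.

Lemma gridS_sub dl k : 0 <= dl -> grid dl k.+1 - grid dl k <= dl.
Proof.
move=> dl0.
have -> : grid dl k.+1 - grid dl k = expR (- (k%:R * dl)) * (1 - expR (- dl)).
  rewrite /grid -natr1 mulrDl mul1r opprD expRD; ring.
have h1 : expR (- (k%:R * dl)) <= 1 by rewrite -expR0 ler_expR oppr_le0 mulr_ge0.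
have h2 : 0 <= 1 - expR (- dl) by rewrite subr_ge0 -expR0 ler_expR oppr_le0.
rewrite (le_trans (ler_wpM2r h2 h1))// mul1r.
by have := expR_ge1Dx (- dl); lra.
Qed.

End grid.

(** Both factors z of the bound come from expR z - 1 <= z * expR z, which is
    1 - z <= expR (- z) multiplied by expR z. *)
Lemma expR_taylor1_le {R : realType} (z : R) : 0 <= z ->
  expR z - 1 - z <= z ^+ 2 * expR z.
Proof.
move=> z0.
have h : expR z - 1 <= z * expR z.
  have := ler_wpM2l (expR_ge0 z) (expR_ge1Dx (- z)).
  by rewrite -expRD subrr expR0; lra.
have := ler_wpM2l z0 h; have := expR_ge1Dx z; nra.
Qed.

Section pathwise.
Context {R : realType}.
Local Notation mu := (@lebesgue_measure R).
Variables (a T : R) (a0 : 0 <= a) (T0 : 0 < T) (T1 : T < 1).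
Variables x W : R -> R.
Hypothesis cx : {within `[0, 1[, continuous x}.
Hypothesis x00 : x 0 = 0.
Hypothesis eqn : forall t, 0 <= t -> t < 1 ->
  x t = W t - \int[mu]_(s in `[0, t]) (a / (1 - s) * x s).

(** The logarithmic time of T. *)
Definition log_horizon : R := - ln (1 - T).
Local Notation L := log_horizon.

Definition mesh n : R := L / n.+1%:R.

Lemma log_horizon_gt0 : 0 < L.
Proof. by rewrite oppr_gt0 ln_lt0// subr_gt0 T1 /= gtrBl. Qed.

Lemma mesh_gt0 n : 0 < mesh n.
Proof. by rewrite divr_gt0 ?log_horizon_gt0. Qed.

Lemma natM_mesh n : n.+1%:R * mesh n = L.
Proof. by rewrite mulrC divfK. Qed.

Lemma le_natM_mesh n k : (k <= n.+1)%N -> k%:R * mesh n <= L.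
Proof.
by move=> kn; rewrite -(natM_mesh n) ler_wpM2r ?ler_nat// ltW// mesh_gt0.
Qed.

(** The grid is built to end exactly at T, so that the terminal value is one of
    its values. *)
Lemma grid_mesh n : grid (mesh n) n.+1 = T.
Proof.
rewrite /grid natM_mesh opprK lnK ?posrE ?subr_gt0//; ring.
Qed.

Lemma grid_itv n k : (k <= n.+1)%N -> grid (mesh n) k \in `[0, T].
Proof.
have d0 := ltW (mesh_gt0 n).
move=> kn; rewrite in_itv /= -(grid0 (mesh n)) -[in _ <= T](grid_mesh n).
by rewrite !ler_grid.
Qed.

Let cxT : {within `[0, T], continuous x}.
Proof.
apply: continuous_subspaceW cx => s /=; rewrite !in_itv /= => /andP[-> sT] /=.
exact: le_lt_trans T1.
Qed.

Lemma bridge_bounded : exists2 M, 0 <= M & forall s, s \in `[0, T] -> `|x s| <= M.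
Proof.
have /compact_bounded[M [_ Mf]] : compact (x @` `[0, T]).
  exact: continuous_compact (@segment_compact _ 0 T).
exists (`|M| + 1) => [|s s0T]; first by rewrite addr_ge0.
apply: Mf; last by exists s.
by rewrite (le_lt_trans (ler_norm M))// ltrDl.
Qed.

Lemma bridge_increment p q : 0 <= p -> p <= q -> q < 1 ->
  x q - x p = W q - W p - \int[mu]_(s in `[p, q]) (a * x s * (1 - s)^-1).
Proof.
move=> p0 pq q1.
have c t : t < 1 -> {within `[0, t], continuous (fun s => a * x s * (1 - s)^-1)}.
  move=> t1; apply: within_continuousM; last exact: within_continuous_oneminus_inv.
  apply: within_continuousM.
    by apply: continuous_subspaceT => ?; exact: cvg_cst.
  apply: continuous_subspaceW cx => s /=; rewrite !in_itv /= => /andP[-> sT] /=.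
  exact: le_lt_trans t1.
have E t : \int[mu]_(s in `[0, t]) (a / (1 - s) * x s) =
    \int[mu]_(s in `[0, t]) (a * x s * (1 - s)^-1).
  by apply: eq_Rintegral => s _; rewrite mulrAC.
rewrite !eqn ?(le_trans p0)//; last exact: le_lt_trans q1.
rewrite !E (Rintegral_segment_split p0 pq (c _ q1)); ring.
Qed.

(** The rescaling by exp (t / 2), t being the logarithmic time of the left end
    of the cell, makes the variance independent of k ([increment_scale_sd]). *)
Definition innov (w : R -> R) (dl : R) k : R :=
  expR (k%:R * dl / 2) * (w (grid dl k.+1) - w (grid dl k)).

(** The autoregression obtained from exp (t / 2) X by freezing the drift on
    each cell. *)
Fixpoint ar_path (th dl : R) (N : nat -> R) k : R :=
  if k is j.+1 then expR (th * dl) * (ar_path th dl N j + N j) else 0.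

(** On one cell, the error made by freezing the drift is o(dl) uniformly, by
    uniform continuity of the path. The errors are propagated with a factor
    exp (th dl) per step, bounded over the whole grid by exp (|th| L), so that
    the n + 1 errors add up to o(1). *)
Lemma ar_path_close : exists2 eps : nat -> R, eps n @[n --> \oo] --> 0 &
  forall n k, (k <= n.+1)%N ->
  `|expR (k%:R * mesh n / 2) * x (grid (mesh n) k)
    - ar_path (1 / 2 - a) (mesh n) (innov W (mesh n)) k| <= eps n.
Proof.
have [M M0 xM] := bridge_bounded.
have [w w0 wP] := continuity_modulus L cxT.
have L0 := log_horizon_gt0.
pose rho n := M * ((a * mesh n) ^+ 2 * expR (a * L)) + a * mesh n * w n.
pose eps n := expR (`|1 / 2 - a| * L) * expR (L / 2) *
  (M * expR (a * L) * (a * L) ^+ 2 * n.+1%:R^-1 + a * L * w n).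
have epsE n : expR (`|1 / 2 - a| * L) * (n.+1%:R * (expR (L / 2) * rho n)) = eps n.
  have : n.+1%:R != 0 :> R by rewrite pnatr_eq0.
  by rewrite /eps /rho /mesh; move: (n.+1%:R : R) => m m0; field.
exists eps.
  rewrite [X in _ --> X](_ : 0 = expR (`|1 / 2 - a| * L) * expR (L / 2) *
    (M * expR (a * L) * (a * L) ^+ 2 * 0 + a * L * 0)); last by ring.
  apply: cvgMr; apply: cvgD; last exact: cvgMr.
  by apply: cvgMr; exact: cvg_harmonic.
move=> n; have dl0 := mesh_gt0 n; have dl0' := ltW dl0.
set dl := mesh n in dl0 dl0' *.
have w0n : 0 <= w n.
  by apply: le_trans (wP n 0 0 _ _ _); rewrite ?normr_ge0// ?bound_itvE ?(ltW T0)//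
    subrr normr0 divr_ge0// ltW.
have rho0 : 0 <= rho n.
  by apply: addr_ge0; do !apply: mulr_ge0 => //; rewrite ?sqr_ge0 ?expR_ge0.
(* the local error made by freezing the drift on one step of the grid *)
have step k : (k < n.+1)%N ->
    `|expR (a * dl) * x (grid dl k.+1) - x (grid dl k)
      - (W (grid dl k.+1) - W (grid dl k))| <= rho n.
  move=> kn.
  have p0 : 0 <= grid dl k by rewrite -(grid0 dl) ler_grid.
  have pq : grid dl k <= grid dl k.+1 by rewrite ler_grid.
  have q1 := grid_lt1 dl k.+1.
  have qT : grid dl k.+1 \in `[0, T] by exact: grid_itv.
  have inT s : s \in `[grid dl k, grid dl k.+1] -> s \in `[0, T].
    rewrite !in_itv /= => /andP[ps sq]; rewrite (le_trans p0)//=.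
    by move: qT; rewrite in_itv /= => /andP[_]; exact: le_trans.
  have cax : {within `[grid dl k, grid dl k.+1], continuous (fun s => a * x s)}.
    apply: within_continuousM.
      by apply: continuous_subspaceT => ?; exact: cvg_cst.
    by apply: continuous_subspaceW cxT => s /=; exact: inT.
  have := @Rintegral_oneminus_approx _ (fun s => a * x s) _ _
    (a * x (grid dl k.+1)) (a * w n) pq q1 cax.
  rewrite ln_gridS => appr.
  have {}appr := appr _.
  have -> : expR (a * dl) * x (grid dl k.+1) - x (grid dl k)
      - (W (grid dl k.+1) - W (grid dl k)) =
    x (grid dl k.+1) * (expR (a * dl) - 1 - a * dl) -
    (\int[mu]_(s in `[grid dl k, grid dl k.+1]) (a * x s * (1 - s)^-1) -
      a * x (grid dl k.+1) * dl).
    have := bridge_increment p0 pq q1; lra.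
  rewrite (le_trans (ler_normB _ _))// /rho lerD//.
    rewrite normrM ler_pM//; first exact: xM.
    have z0 : 0 <= a * dl by rewrite mulr_ge0.
    rewrite ger0_norm; last by have := expR_ge1Dx (a * dl); lra.
    apply: le_trans (expR_taylor1_le z0) _.
    rewrite ler_wpM2l ?sqr_ge0// ler_expR ler_wpM2l//.
    by rewrite -(natM_mesh n) ler_peMl// ler1n.
  rewrite [leRHS]mulrAC; apply: appr => s sI.
  rewrite -mulrBr normrM (ger0_norm a0) ler_wpM2l//.
  apply: wP => //; first exact: inT.
  have -> : L / n.+1%:R = dl by [].
  rewrite distrC ger0_norm.
    apply: le_trans (gridS_sub k dl0'); rewrite lerD2l lerN2.
    by move: sI; rewrite in_itv /= => /andP[].
  by rewrite subr_ge0; move: sI; rewrite in_itv /= => /andP[].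
move=> k kn.
pose C := expR (L / 2) * rho n.
have C0 : 0 <= C by rewrite mulr_ge0 ?expR_ge0.
suff : `|expR (k%:R * dl / 2) * x (grid dl k)
    - ar_path (1 / 2 - a) dl (innov W dl) k|
    <= expR (`|1 / 2 - a| * (k%:R * dl)) * (k%:R * C).
  move=> /le_trans; apply; rewrite -epsE.
  rewrite ler_pM ?expR_ge0 ?mulr_ge0//.
    by rewrite ler_expR ler_wpM2l// le_natM_mesh.
  by rewrite ler_wpM2r// ler_nat.
elim: k kn => [|k ih] kn.
  by rewrite /= grid0 x00 mulr0 subrr normr0 mulr_ge0 ?expR_ge0// mulr_ge0.
have {ih} := ih (ltnW kn) => /=.
set y := ar_path _ _ _ k; set r := (X in `|X|) => rle.
set th := 1 / 2 - a in rle *.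
pose rk := expR (a * dl) * x (grid dl k.+1) - x (grid dl k)
  - (W (grid dl k.+1) - W (grid dl k)).
have -> : expR (k.+1%:R * dl / 2) * x (grid dl k.+1)
    - expR (th * dl) * (y + innov W dl k) =
    expR (th * dl) * (r + expR (k%:R * dl / 2) * rk).
  have E : expR (k.+1%:R * dl / 2) = expR (th * dl) * expR (k%:R * dl / 2) * expR (a * dl).
    by rewrite -!expRD; congr expR; rewrite /th -(natr1 k); field.
  by rewrite E /r /rk /innov; ring.
rewrite normrM (ger0_norm (expR_ge0 _)).
have rkle : `|expR (k%:R * dl / 2) * rk| <= C.
  rewrite normrM (ger0_norm (expR_ge0 _)) /C ler_pM ?expR_ge0//; last exact: step.
  by rewrite ler_expR ler_pM2r// le_natM_mesh// ltnW.
have e1 : expR (th * dl) <= expR (`|th| * dl).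
  by rewrite ler_expR ler_wpM2r// ler_norm.
have e2 : 1 <= expR (`|th| * (k%:R * dl)).
  by rewrite -expR0 ler_expR mulr_ge0// mulr_ge0.
have h : `|r + expR (k%:R * dl / 2) * rk| <=
    expR (`|th| * (k%:R * dl)) * (k.+1%:R * C).
  rewrite (le_trans (ler_normD _ _))// -(natr1 k) mulrDl mul1r mulrDr lerD//.
  by rewrite (le_trans rkle)// ler_peMl.
rewrite (le_trans (ler_pM (expR_ge0 _) (normr_ge0 _) e1 h))// [leLHS]mulrA -expRD.
by rewrite le_eqVlt; apply/orP; left; apply/eqP; congr (expR _ * _);
  rewrite -(natr1 k); ring.
Qed.

End pathwise.

(** * Limits as the mesh vanishes *)

Section mesh_limits.
Context {R : realType}.
Variables (T : R) (T0 : 0 < T) (T1 : T < 1).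
Local Notation L := (log_horizon T).
Local Notation mesh := (mesh T).

Lemma expR_taylor1_norm (z : R) : `|expR z - 1 - z| <= z ^+ 2 * expR `|z|.
Proof.
have h : 0 <= expR z - 1 - z by have := expR_ge1Dx z; lra.
rewrite (ger0_norm h); have [z0|z0] := leP 0 z.
  by rewrite ger0_norm// expR_taylor1_le.
have h1 : expR z - 1 <= z * expR z.
  have := ler_wpM2l (expR_ge0 z) (expR_ge1Dx (- z)).
  by rewrite -expRD subrr expR0; lra.
have : 1 <= expR `|z| by rewrite -expR0 ler_expR.
have := expR_ge1Dx z; nra.
Qed.

Lemma cvg_mesh : mesh n @[n --> \oo] --> 0.
Proof. by rewrite -(mulr0 L); apply: cvgMr; exact: cvg_harmonic. Qed.

Lemma cvg_expR_mesh (c : R) : (expR (c * mesh n) - 1) / mesh n @[n --> \oo] --> c.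
Proof.
apply/cvgrPdist_le => e e0.
have : c ^+ 2 * expR (`|c| * L) * mesh n @[n --> \oo] --> 0.
  by rewrite -(mulr0 (c ^+ 2 * expR (`|c| * L))); apply: cvgMr; exact: cvg_mesh.
move=> /cvgrPdist_le /(_ e e0); apply: filterS => n.
have d0 := mesh_gt0 T0 T1 n.
rewrite sub0r normrN => /(le_trans (ler_norm _)) ne; apply: le_trans ne.
have -> : c - (expR (c * mesh n) - 1) / mesh n =
    - ((expR (c * mesh n) - 1 - c * mesh n) / mesh n).
  by field; rewrite gt_eqF.
rewrite normrN normrM normfV (gtr0_norm d0) ler_pdivrMr//.
apply: le_trans (expR_taylor1_norm _) _.
rewrite normrM (gtr0_norm d0) exprMn.
have -> : c ^+ 2 * expR (`|c| * L) * mesh n * mesh n =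
  c ^+ 2 * mesh n ^+ 2 * expR (`|c| * L) by ring.
apply: ler_wpM2l; first by rewrite mulr_ge0 ?sqr_ge0.
rewrite ler_expR ler_wpM2l//.
by rewrite -(natM_mesh T n) ler_peMl ?(ltW d0) ?ler1n.
Qed.

Lemma cvg_expR_mesh1 (c : R) : expR (c * mesh n) @[n --> \oo] --> (1 : R).
Proof.
rewrite -expR0; apply: continuous_cvg; first exact: continuous_expR.
by rewrite -(mulr0 c); apply: cvgMr; exact: cvg_mesh.
Qed.

Lemma cvg_step_var : step_var (mesh n) / mesh n @[n --> \oo] --> (1 : R).
Proof.
rewrite -[X in _ --> X]opprK.
under eq_cvg => n.
  rewrite (_ : _ / _ = - ((expR (- 1 * mesh n) - 1) / mesh n)); last first.
    by rewrite /step_var mulN1r -[RHS]mulNr opprB.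
  over.
by apply: cvgN; exact: cvg_expR_mesh.
Qed.

(** The cost is a product of two increments of exponentials divided by the
    variance, and each of the three is of the order of the mesh. *)
Lemma cvg_step_cost (th u : R) :
  step_cost th u (mesh n) / mesh n @[n --> \oo] --> (u ^+ 2 - th ^+ 2) / 2.
Proof.
under eq_cvg => n.
  rewrite (_ : _ / _ = expR (- (th + u) * mesh n) *
    ((expR ((u - th) * mesh n) - 1) / mesh n) *
    ((expR ((u + th) * mesh n) - 1) / mesh n) / (2 * (step_var (mesh n) / mesh n)));
    last first.
    have d0 := mesh_gt0 T0 T1 n; have v0 := step_var_gt0 d0.
    move: v0 d0; rewrite /step_cost mulNr.
    move: (step_var _) => v; move: (mesh n) => dl v0 d0.
    by field; rewrite !gt_eqF.
  over.
rewrite (_ : _ / _ = 1 * (u - th) * (u + th) / (2 * 1)); last by field.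
apply: cvgM; last first.
  by apply: cvgV; [rewrite mulr1 pnatr_eq0|apply: cvgMr; exact: cvg_step_var].
apply: cvgM; last exact: cvg_expR_mesh.
by apply: cvgM; [exact: cvg_expR_mesh1|exact: cvg_expR_mesh].
Qed.

Lemma laplace_sol0 (th u mu : R) : laplace_sol th u mu 0 = 1.
Proof. by rewrite /laplace_sol !mulr0 expR0; move: (_ / u) => b; field. Qed.

Lemma cvg_step_weight (th u mu : R) : 0 < u ->
  step_weight th u mu (mesh n) 0 @[n --> \oo] --> mu.
Proof.
move=> u0; pose b := (2 * mu - th) / u.
rewrite [X in _ --> X](_ : mu = ((1 + b) * (u + th) + (1 - b) * (th - u)) / 2 /
  (2 * 1 * 1)); last by rewrite /b; field; rewrite gt_eqF.
under eq_cvg => n.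
  rewrite (_ : step_weight _ _ _ _ _ =
    ((1 + b) * ((expR ((u + th) * mesh n) - 1) / mesh n) +
     (1 - b) * ((expR ((th - u) * mesh n) - 1) / mesh n)) / 2 /
    (2 * expR (2 * th * mesh n) * (step_var (mesh n) / mesh n))); last first.
    have d0 := mesh_gt0 T0 T1 n; have v0 := step_var_gt0 d0.
    have e0 := expR_gt0 (2 * th * mesh n).
    rewrite /step_weight laplace_sol0 add0r /laplace_sol -/b.
    move: v0 d0 e0; move: (expR (2 * th * mesh n)) (step_var _) => e v.
    by move=> v0 d0 e0; field; rewrite !gt_eqF.
  over.
apply: cvgM.
  by apply: cvgM; [apply: cvgD; apply: cvgMr; exact: cvg_expR_mesh|exact: cvg_cst].
apply: cvgV; first by rewrite !mulr1 pnatr_eq0.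
by apply: cvgM; [apply: cvgMr; exact: cvg_expR_mesh1|exact: cvg_step_var].
Qed.

End mesh_limits.

Section pathwise_limits.
Context {R : realType}.
Local Notation mu := (@lebesgue_measure R).
Variables (a T : R) (a0 : 0 <= a) (T0 : 0 < T) (T1 : T < 1).
Variables x W : R -> R.
Hypothesis cx : {within `[0, 1[, continuous x}.
Hypothesis x00 : x 0 = 0.
Hypothesis eqn : forall t, 0 <= t -> t < 1 ->
  x t = W t - \int[mu]_(s in `[0, t]) (a / (1 - s) * x s).
Local Notation L := (log_horizon T).
Local Notation mesh := (mesh T).

Definition energy : R := \int[mu]_(s in `[0, T]) (x s ^+ 2 / (1 - s) ^+ 2).

(** The process exp (t / 2) X at the points of the grid. *)
Definition scaled n k : R := expR (k%:R * mesh n / 2) * x (grid (mesh n) k).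

Let cxT : {within `[0, T], continuous x}.
Proof.
apply: continuous_subspaceW cx => s /=; rewrite !in_itv /= => /andP[-> sT] /=.
exact: le_lt_trans T1.
Qed.

Lemma scaled_sqr n k :
  scaled n k ^+ 2 = x (grid (mesh n) k) ^+ 2 * (1 - grid (mesh n) k)^-1.
Proof.
rewrite oneminus_grid -expRN opprK /scaled exprMn -expRM_natl [RHS]mulrC.
by congr (expR _ * _); field.
Qed.

(** In logarithmic time the energy is the integral of the square of
    exp (t / 2) X, and these are its Riemann sums on the regular grid. *)
Lemma cvg_riemann_energy :
  mesh n * \sum_(0 <= k < n.+1) scaled n k ^+ 2 @[n --> \oo] --> energy.
Proof.
pose f s := x s ^+ 2 * (1 - s)^-1.
have cf : {within `[0, T], continuous f}.
  apply: within_continuousM; last exact: within_continuous_oneminus_inv.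
  exact: (within_continuousM cxT cxT).
have [w w0 wP] := continuity_modulus L cf.
have key n k : (k <= n.+1)%N ->
    `|\int[mu]_(s in `[0, grid (mesh n) k]) (f s * (1 - s)^-1)
      - mesh n * \sum_(0 <= j < k) scaled n j ^+ 2| <= k%:R * (w n * mesh n).
  have d0 := mesh_gt0 T0 T1 n; have d0' := ltW d0.
  elim: k => [|k ih] kn.
    by rewrite grid0 set_itv1 Rintegral_set1 big_geq// mulr0 subr0 normr0 mul0r.
  have p0 : 0 <= grid (mesh n) k by rewrite -(grid0 (mesh n)) ler_grid.
  have pq : grid (mesh n) k <= grid (mesh n) k.+1 by rewrite ler_grid.
  have q1 := grid_lt1 (mesh n) k.+1.
  have qT : grid (mesh n) k.+1 \in `[0, T] by exact: grid_itv.
  have inT s : s \in `[0, grid (mesh n) k.+1] -> s \in `[0, T].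
    rewrite !in_itv /= => /andP[-> sq] /=.
    by move: qT; rewrite in_itv /= => /andP[_]; exact: le_trans.
  have inT' s : s \in `[grid (mesh n) k, grid (mesh n) k.+1] -> s \in `[0, T].
    by rewrite in_itv /= => /andP[ps sq]; apply: inT; rewrite in_itv /= (le_trans p0).
  rewrite (Rintegral_segment_split p0 pq); last first.
    apply: within_continuousM; last exact: within_continuous_oneminus_inv.
    by apply: continuous_subspaceW cf => s /=; exact: inT.
  rewrite big_nat_recr//= mulrDr opprD addrACA -(natr1 k) mulrDl mul1r.
  rewrite (le_trans (ler_normD _ _))// lerD//; first exact/ih/ltnW.
  rewrite scaled_sqr -/(f _) [X in _ - X]mulrC.
  have := @Rintegral_oneminus_approx _ f _ _ (f (grid (mesh n) k)) (w n) pq q1.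
  rewrite ln_gridS; apply.
    by apply: continuous_subspaceW cf => s /=; exact: inT'.
  move=> s sI; apply: wP; [exact: inT'|apply: inT'|].
    by rewrite in_itv /= lexx.
  move: sI; rewrite in_itv /= => /andP[ps sq].
  rewrite ger0_norm ?subr_ge0//; apply: le_trans (gridS_sub k d0').
  by rewrite lerD2r.
have energyE : energy = \int[mu]_(s in `[0, T]) (f s * (1 - s)^-1).
  by apply: eq_Rintegral => s _; rewrite /f -mulrA -invfM -expr2.
apply/cvgrPdist_le => e e0.
have : L * w n @[n --> \oo] --> 0 by rewrite -(mulr0 L); exact: cvgMr.
move=> /cvgrPdist_le /(_ e e0); apply: filterS => n.
rewrite sub0r normrN => /(le_trans (ler_norm _)) ne; apply: le_trans ne.
have := key n n.+1 (leqnn _).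
rewrite grid_mesh// -energyE => /le_trans; apply.
by rewrite mulrCA natM_mesh mulrC.
Qed.

Let y n k := ar_path (1 / 2 - a) (mesh n) (innov W (mesh n)) k.

(** The squares of the autoregression and of the process differ by at most
    eps (2 C + eps), where C bounds the process and eps the distance of
    [ar_path_close]. *)
Lemma cvg_ar_energy :
  mesh n * \sum_(0 <= k < n.+1) y n k ^+ 2 @[n --> \oo] --> energy.
Proof.
have [eps eps0 epsP] := ar_path_close a0 T0 T1 cx x00 eqn.
have [M M0 xM] := bridge_bounded T1 cx.
pose C := expR (L / 2) * M.
have cmp : (mesh n * \sum_(0 <= k < n.+1) scaled n k ^+ 2
    - mesh n * \sum_(0 <= k < n.+1) y n k ^+ 2) @[n --> \oo] --> 0.
  apply/cvgrPdist_le => e e0.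
  have : L * (eps n * (2 * C + eps n)) @[n --> \oo] --> 0.
    rewrite -[X in _ --> X](_ : L * (0 * (2 * C + 0)) = 0); last by rewrite mul0r mulr0.
    apply: cvgMr; apply: cvgM => //; apply: cvgD => //; exact: cvg_cst.
  move=> /cvgrPdist_le /(_ e e0); apply: filterS => n.
  have d0 := mesh_gt0 T0 T1 n; have d0' := ltW d0.
  rewrite sub0r normrN => /(le_trans (ler_norm _)) ne; apply: le_trans ne.
  rewrite sub0r normrN -mulrBr -sumrB normrM (gtr0_norm d0).
  suff h : `|\sum_(0 <= k < n.+1) (scaled n k ^+ 2 - y n k ^+ 2)|
      <= n.+1%:R * (eps n * (2 * C + eps n)).
    by rewrite (le_trans (ler_wpM2l d0' h))// [leLHS]mulrCA mulrA natM_mesh.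
  rewrite mulr_natl.
  apply: le_trans (ler_norm_sum _ _ _) _.
  rewrite -[X in _ *+ X]subn0 -sumr_const_nat big_nat_cond [leRHS]big_nat_cond.
  apply: ler_sum => k /andP[/andP[_ kn] _].
  have := epsP n k (ltnW kn); rewrite -/(scaled n k) -/(y n k) => h.
  have sC : `|scaled n k| <= C.
    rewrite normrM (ger0_norm (expR_ge0 _)) ler_pM ?expR_ge0//.
      by rewrite ler_expR ler_pM2r// le_natM_mesh// ltnW.
    by apply: xM; apply: grid_itv => //; exact: ltnW.
  rewrite subr_sqr normrM ler_pM//.
  have -> : scaled n k + y n k = 2 * scaled n k - (scaled n k - y n k) by ring.
  by rewrite (le_trans (ler_normB _ _))// lerD// normrM ger0_norm// ler_pM2l.
rewrite -[energy]subr0.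
rewrite (_ : (fun n => _) = (fun n => mesh n * \sum_(0 <= k < n.+1) scaled n k ^+ 2)
  \- (fun n => mesh n * \sum_(0 <= k < n.+1) scaled n k ^+ 2
      - mesh n * \sum_(0 <= k < n.+1) y n k ^+ 2)); last first.
  by apply/funext => n /=; rewrite subKr.
by apply: cvgB => //; exact: cvg_riemann_energy.
Qed.

Lemma cvg_ar_terminal : y n n.+1 ^+ 2 @[n --> \oo] --> x T ^+ 2 / (1 - T).
Proof.
have [eps eps0 epsP] := ar_path_close a0 T0 T1 cx x00 eqn.
have -> : x T ^+ 2 / (1 - T) = (expR (L / 2) * x T) ^+ 2.
  rewrite exprMn -expRM_natl (_ : 2%:R * (L / 2) = L); last by field.
  by rewrite expRN lnK ?posrE ?subr_gt0// mulrC.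
have : y n n.+1 @[n --> \oo] --> expR (L / 2) * x T.
  apply/cvgrPdist_le => e e0.
  move/cvgrPdist_le : eps0 => /(_ e e0); apply: filterS => n.
  rewrite sub0r normrN => /(le_trans (ler_norm _)) ne; apply: le_trans ne.
  by have := epsP n n.+1 (leqnn _); rewrite grid_mesh// natM_mesh.
by move=> h; under eq_cvg do rewrite expr2; rewrite expr2; exact: cvgM.
Qed.

(** The discrete Ito formula for X ^ 2 / (1 - s). By 2 x (y - x) =
    y ^ 2 - x ^ 2 - (y - x) ^ 2, twice the Ito sum plus the sum of the weighted
    squared increments of X is exactly a telescoping sum minus a Riemann sum of
    the energy. The squared increments of X are replaced by those of W, from
    which they differ by the drift, of the order of the mesh. *)
Lemma cvg_ito_energy :
  (2 * \sum_(0 <= k < n.+1) (x (grid (mesh n) k) / (1 - grid (mesh n) k)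
       * (x (grid (mesh n) k.+1) - x (grid (mesh n) k)))
   + \sum_(0 <= k < n.+1) innov W (mesh n) k ^+ 2) @[n --> \oo]
  --> x T ^+ 2 / (1 - T) - energy.
Proof.
have [M M0 xM] := bridge_bounded T1 cx.
have [w w0 wP] := continuity_modulus L cxT.
have L0 := log_horizon_gt0 T0 T1.
pose F n k := scaled n k ^+ 2.
(* the summation by parts, and the replacement of dX by dW in the squares *)
pose main n := expR (- 1 * mesh n) * F n n.+1
  - step_var (mesh n) / mesh n * (mesh n * \sum_(0 <= k < n.+1) F n k).
pose rem n k := innov W (mesh n) k ^+ 2
  - expR (k%:R * mesh n) * (x (grid (mesh n) k.+1) - x (grid (mesh n) k)) ^+ 2.
rewrite (_ : (fun n => _) = main \+ (fun n => \sum_(0 <= k < n.+1) rem n k));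
  last first.
  apply/funext => n /=.
  have -> : main n = \sum_(0 <= k < n.+1) (expR (- 1 * mesh n) * F n k.+1 - F n k).
    have F0 : F n 0 = 0 by rewrite /F /scaled grid0 x00 mulr0 expr0n.
    rewrite sumrB -mulr_sumr big_nat_recr//=.
    rewrite [in RHS](_ : \sum_(0 <= i < n) F n i.+1 = \sum_(0 <= k < n.+1) F n k);
      last by rewrite [RHS]big_nat_recl// F0 add0r.
    rewrite /main /step_var mulN1r.
    have d0 := mesh_gt0 T0 T1 n; move: (\sum_(0 <= k < n.+1) F n k) => S.
    by move: (expR _) d0 => e d0; field; rewrite gt_eqF.
  rewrite mulr_sumr -!big_split /=; apply: eq_bigr => k _.
  rewrite /rem /F !scaled_sqr !oneminus_grid -!expRN !opprK.
  have -> : expR (k.+1%:R * mesh n) = expR (k%:R * mesh n) * expR (mesh n).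
    by rewrite -expRD -(natr1 k) mulrDl mul1r.
  have := expR_gt0 (mesh n); rewrite mulN1r expRN; move: (expR (mesh n)) => e e0.
  by field; rewrite gt_eqF.
rewrite -[X in _ --> X]addr0; apply: cvgD.
  apply: cvgB.
    rewrite -[X in _ --> X]mul1r; apply: cvgM; first exact: cvg_expR_mesh1.
    rewrite (_ : (fun n => _) = fun=> x T ^+ 2 / (1 - T)); first exact: cvg_cst.
    by apply/funext => n; rewrite /F scaled_sqr grid_mesh.
  rewrite -[X in _ --> X]mul1r; apply: cvgM; first exact: cvg_step_var.
  exact: cvg_riemann_energy.
apply/cvgrPdist_le => e e0.
have : expR L * (a * M * (L * (2 * w n + a * M * mesh n))) @[n --> \oo] --> 0.
  rewrite -[X in _ --> X](_ : expR L * (a * M * (L * (2 * 0 + a * M * 0))) = 0);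
    last by ring.
  do 3 apply: cvgMr; apply: cvgD; first exact: cvgMr.
  by apply: cvgMr; exact: cvg_mesh.
move=> /cvgrPdist_le /(_ e e0); apply: filterS => n.
have d0 := mesh_gt0 T0 T1 n; have d0' := ltW d0.
rewrite sub0r normrN => /(le_trans (ler_norm _)) ne; apply: le_trans ne.
rewrite sub0r normrN.
have -> : expR L * (a * M * (L * (2 * w n + a * M * mesh n))) =
  n.+1%:R * (expR L * (a * M * mesh n * (2 * w n + a * M * mesh n))).
  by rewrite -[X in _ * (_ * (X * _)) = _](natM_mesh T n); ring.
rewrite mulr_natl; apply: le_trans (ler_norm_sum _ _ _) _.
rewrite -[X in _ *+ X]subn0 -sumr_const_nat big_nat_cond [leRHS]big_nat_cond.
apply: ler_sum => k /andP[/andP[_ kn] _].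
have p0 : 0 <= grid (mesh n) k by rewrite -(grid0 (mesh n)) ler_grid.
have pq : grid (mesh n) k <= grid (mesh n) k.+1 by rewrite ler_grid.
have q1 := grid_lt1 (mesh n) k.+1.
have qT : grid (mesh n) k.+1 \in `[0, T] by exact: grid_itv.
have pT : grid (mesh n) k \in `[0, T] by apply: grid_itv => //; exact: ltnW.
have inT s : s \in `[grid (mesh n) k, grid (mesh n) k.+1] -> s \in `[0, T].
  rewrite !in_itv /= => /andP[ps sq]; rewrite (le_trans p0)//=.
  by move: qT; rewrite in_itv /= => /andP[_]; exact: le_trans.
set dX := x (grid (mesh n) k.+1) - x (grid (mesh n) k).
pose D := \int[mu]_(s in `[grid (mesh n) k, grid (mesh n) k.+1])
  (a * x s * (1 - s)^-1).
have dW : W (grid (mesh n) k.+1) - W (grid (mesh n) k) = dX + D.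
  by rewrite /dX (bridge_increment cx eqn p0 pq q1) -/D subrK.
have Dle : `|D| <= a * M * mesh n.
  have := @Rintegral_oneminus_approx _ (fun s => a * x s) _ _ 0 (a * M) pq q1.
  rewrite ln_gridS mul0r subr0; apply.
    apply: within_continuousM.
      by apply: continuous_subspaceT => ?; exact: cvg_cst.
    by apply: continuous_subspaceW cxT => s /=; exact: inT.
  move=> s /inT sT; rewrite subr0 normrM (ger0_norm a0) ler_wpM2l//.
  exact: xM.
have dXle : `|dX| <= w n.
  apply: wP => //; rewrite ger0_norm ?subr_ge0//; exact: gridS_sub.
rewrite /rem /innov exprMn -expRM_natl (_ : 2%:R * (_ / 2) = k%:R * mesh n);
  last by field.
rewrite -mulrBr dW normrM (ger0_norm (expR_ge0 _)) ler_pM ?expR_ge0//.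
  by rewrite ler_expR le_natM_mesh// ltnW.
have -> : (dX + D) ^+ 2 - dX ^+ 2 = D * (2 * dX + D) by ring.
rewrite normrM ler_pM// (le_trans (ler_normD _ _))// lerD// normrM ger0_norm//.
by rewrite ler_pM2l.
Qed.

End pathwise_limits.

(** * The Laplace transform of the energy and of the terminal value *)

Section brownian_increments.
Context {d : measure_display} {Om : measurableType d} {R : realType}
  (P : probability Om R).
Variables (W : R -> {RV P >-> R}) (W_bm : brownian_motion01 W).
Variables (dl : R) (dl0 : 0 < dl).

Definition increment k : {RV P >-> R} := W (grid dl k.+1) - W (grid dl k).

Definition increment_scale k : R := expR (k%:R * dl / 2).

Definition increment_sd k : R := Num.sqrt (grid dl k.+1 - grid dl k).

Lemma increment_scale_gt0 k : 0 < increment_scale k.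
Proof. exact: expR_gt0. Qed.

Lemma increment_scale_sd k : (increment_scale k * increment_sd k) ^+ 2 = step_var dl.
Proof.
rewrite exprMn sqr_sqrtr ?subr_ge0 ?ler_grid ?ltW// /increment_scale -expRM_natl.
rewrite (_ : 2%:R * (_ / 2) = k%:R * dl); last by field.
rewrite /grid /step_var -(natr1 k) mulrDl mul1r opprD expRD.
have := expR_gt0 (k%:R * dl); rewrite expRN; move: (expR _) => e e0.
by field; rewrite gt_eqF.
Qed.

Lemma increment_indep n (B : nat -> set R) : (forall i, measurable (B i)) ->
  (P [set w | forall i, (i < n)%N -> B i (increment i w)] =
   \prod_(0 <= i < n) P (increment i @^-1` B i))%E.
Proof.
move=> mB; case: W_bm => _ _ _ /(_ n (grid dl)) indep.
have {}indep := indep _ (ltW (grid_lt1 _ _)) _.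
rewrite grid0 in indep.
have {}indep := indep (lexx _) (fun i _ => ler_grid (ltW dl0) (leqnSn i)).
rewrite big_mkord -(indep (fun i => B i))//; congr (P _).
apply/seteqP; split => w /= h i; first by apply: h.
by move=> ni; exact: (h (Ordinal ni)).
Qed.

Lemma increment_law k (B : set R) : measurable B ->
  distribution P (increment k) B = normal_prob 0 (increment_sd k) B.
Proof.
case: W_bm => _ _ + _; apply; last exact/ltW/grid_lt1.
- by rewrite -(grid0 dl) ler_grid// ltW.
- exact: ltr_grid.
Qed.

Let path w t := W t w.

Lemma measurable_innov k : measurable_fun setT (fun w => innov (path w) dl k).
Proof. by apply: measurable_funM => //; exact: (measurable_funPT (increment k)). Qed.

Lemma chain_sqrE n w : chain increment (sqr_step increment_scale) 0 n w =
  \sum_(0 <= k < n) innov (path w) dl k ^+ 2.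
Proof.
elim: n => [|n ih]; first by rewrite big_geq.
by rewrite big_nat_recr//= /sqr_step ih; exact: erefl.
Qed.

Lemma chain_arE th u n w :
  chain increment (ar_step increment_scale th u dl) (0, 0) n w =
  (step_cost th u dl * \sum_(0 <= k < n) ar_path th dl (innov (path w) dl) k ^+ 2,
   ar_path th dl (innov (path w) dl) n).
Proof.
elim: n => [|n ih] /=; first by rewrite big_geq// mulr0.
rewrite ih /ar_step /= big_nat_recr//=; congr (_, _).
by rewrite mulrDr.
Qed.

Lemma laplace_bm_sqr s n : 0 <= s ->
  (\int[P]_w (expR (- (s * \sum_(0 <= k < n) innov (path w) dl k ^+ 2)))%:E =
   ((Num.sqrt (1 + 2 * s * step_var dl))^-1 ^+ n)%:E)%E.
Proof.
move=> s0; under eq_integral do rewrite -chain_sqrE.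
exact: (laplace_sum_sqr (step_var_gt0 dl0) increment_scale_gt0 increment_scale_sd
  (fun B => @increment_indep n B) (fun k _ => @increment_law k)).
Qed.

(** The autoregression driven by the Brownian increments has, on every grid,
    the Laplace transform of the continuous-time functional. *)
Lemma laplace_bm_ar th u mu n :
  `|th| <= u -> 0 < u -> 0 <= mu ->
  let y w := ar_path th dl (innov (path w) dl) in
  (\int[P]_w (expR (- (step_cost th u dl * \sum_(0 <= k < n) y w k ^+ 2)
     - step_weight th u mu dl 0 * y w n ^+ 2))%:E =
   (Num.sqrt (laplace_sol th u mu (n%:R * dl))^-1)%:E)%E.
Proof.
move=> thu u0 mu0 y.
have := laplace_ar (step_var_gt0 dl0) increment_scale_gt0 increment_scale_sd
  (fun B => @increment_indep n B) (fun k _ => @increment_law k) thu u0 mu0 dl0 erefl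
  (leqnn n) (lexx 0).
rewrite laplace_sol0 add0r div1r => <-.
by apply: eq_integral => w _; rewrite chain_arE.
Qed.

End brownian_increments.

Section bounded_convergence.
Context {d : measure_display} {Om : measurableType d} {R : realType}
  (P : probability Om R).

Lemma bounded_convergence_prob (f : nat -> Om -> R) (g : Om -> R) :
  (forall n, measurable_fun setT (f n)) -> measurable_fun setT g ->
  {ae P, forall w, f n w @[n --> \oo] --> g w} ->
  (forall n w, `|f n w| <= 1) ->
  (\int[P]_w (f n w)%:E @[n --> \oo] --> \int[P]_w (g w)%:E)%E.
Proof.
move=> mf mg fg f1.
have [] := @dominated_convergence _ _ _ P setT measurableT
  (fun n w => (f n w)%:E) (EFin \o g) (cst 1%E).
- by move=> n; exact/measurable_EFinP.
- exact/measurable_EFinP.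
- by apply: filterS fg => w h _; apply: cvg_EFin => //; exact: nearW.
- exact: finite_measure_integrable_cst.
- by apply: aeW => w n _; rewrite lee_fin.
- by [].
Qed.

End bounded_convergence.

Section bridge_laplace.
Context {d : measure_display} {Om : measurableType d} {R : realType}
  (P : probability Om R).
Variables (a T : R) (a0 : 0 <= a) (T0 : 0 < T) (T1 : T < 1).
Variables (W X : R -> {RV P >-> R}).
Hypotheses (W_bm : brownian_motion01 W) (X_bridge : alpha_brownian_bridge a W X).
Local Notation L := (log_horizon T).
Local Notation th := (1 / 2 - a).

Let path (Z : R -> {RV P >-> R}) w t := Z t w.

(** The energy as an upper limit of Riemann sums. This is a measurable function
    of w whatever the paths, and equals the pathwise integral almost surely;
    the integral itself need not be measurable in w off the event of measure
    one where the path is continuous. *)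
Definition bridge_energy w : R :=
  fine (limn_esup (fun n =>
    (mesh T n * \sum_(0 <= k < n.+1) scaled T (path X w) n k ^+ 2)%:E)).

Definition bridge_terminal w : R := X T w ^+ 2 / (1 - T).

Lemma measurable_bridge_energy : measurable_fun setT bridge_energy.
Proof.
apply: (measurableT_comp (fine_measurable measurableT)).
apply: measurable_fun_limn_esup => n; apply/measurable_EFinP.
apply: measurable_funM => //; apply: measurable_sum => k.
by apply: measurable_funX; apply: measurable_funM.
Qed.

Lemma measurable_bridge_terminal : measurable_fun setT bridge_terminal.
Proof. by apply: measurable_funM => //; exact: measurable_funX. Qed.

Lemma bridge_terminal_ge0 w : 0 <= bridge_terminal w.
Proof. by rewrite divr_ge0 ?sqr_ge0 ?subr_ge0 ?ltW. Qed.

Lemma bridge_energyE : {ae P, forall w, bridge_energy w = energy T (path X w)}.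
Proof.
apply: filterS X_bridge => w [cX X0 eqX].
have h := cvg_riemann_energy T0 T1 cX.
rewrite /bridge_energy is_cvg_limn_esupE.
  by rewrite (cvg_lim _ (cvg_EFin _ h))//; exact: nearW.
by apply/cvg_ex; exists (energy T (path X w))%:E; apply: cvg_EFin => //; exact: nearW.
Qed.

Lemma bridge_energy_ge0 w : 0 <= bridge_energy w.
Proof.
apply/fine_ge0/limf_esup_ge0 => [|n]; first exact: filter_not_empty.
rewrite lee_fin mulr_ge0 ?(ltW (mesh_gt0 T0 T1 n))//.
by apply: sumr_ge0 => k _; exact: sqr_ge0.
Qed.

(** On every grid the functional has the expected transform; it is bounded by 1
    and converges almost surely to the functional of the bridge. *)
Lemma bridge_laplace u mu : `|th| <= u -> 0 < u -> 0 <= mu ->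
  (\int[P]_w (expR (- ((u ^+ 2 - th ^+ 2) / 2 * bridge_energy w)
     - mu * bridge_terminal w))%:E =
   (Num.sqrt (laplace_sol th u mu L)^-1)%:E)%E.
Proof.
move=> thu u0 mu0.
pose y n w := ar_path th (mesh T n) (innov (path W w) (mesh T n)).
pose f n w := expR (- (step_cost th u (mesh T n) *
    \sum_(0 <= k < n.+1) y n w k ^+ 2)
  - step_weight th u mu (mesh T n) 0 * y n w n.+1 ^+ 2).
have my n k : measurable_fun setT (y n ^~ k).
  elim: k => [|k ih] /=; first exact: measurable_cst.
  by apply: measurable_funM => //; apply: measurable_funD => //; exact: measurable_innov.
have fE n : (\int[P]_w (f n w)%:E = (Num.sqrt (laplace_sol th u mu L)^-1)%:E)%E.
  have := laplace_bm_ar W_bm (mesh_gt0 T0 T1 n) n.+1 thu u0 mu0.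
  by rewrite natM_mesh.
have : (\int[P]_w (f n w)%:E @[n --> \oo] -->
    \int[P]_w (expR (- ((u ^+ 2 - th ^+ 2) / 2 * bridge_energy w)
     - mu * bridge_terminal w))%:E)%E.
  apply: bounded_convergence_prob.
  - move=> n; apply: measurableT_comp => //; apply: measurable_funB.
      apply: measurableT_comp => //; apply: measurable_funM => //.
      by apply: measurable_sum => k; exact: measurable_funX.
    by apply: measurable_funM => //; exact: measurable_funX.
  - apply: measurableT_comp => //; apply: measurable_funB.
      apply: measurableT_comp => //; apply: measurable_funM => //.
      exact: measurable_bridge_energy.
    by apply: measurable_funM => //; exact: measurable_bridge_terminal.
  - apply: filterS2 X_bridge bridge_energyE => w [cX X0 eqX] ->.
    apply: continuous_cvg; first exact: continuous_expR.
    apply: cvgB; last first.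
      apply: cvgM; first exact: cvg_step_weight.
      by have := cvg_ar_terminal a0 T0 T1 cX X0 eqX.
    apply: cvgN.
    rewrite (_ : (fun n => _) = (fun n => step_cost th u (mesh T n) / mesh T n *
      (mesh T n * \sum_(0 <= k < n.+1) y n w k ^+ 2))); last first.
      by apply/funext => n; rewrite mulrA divfK// gt_eqF// mesh_gt0.
    apply: cvgM; first exact: cvg_step_cost.
    by have := cvg_ar_energy a0 T0 T1 cX X0 eqX.
  - move=> n w; have d0 := mesh_gt0 T0 T1 n.
    rewrite ger0_norm ?expR_ge0// -expR0 ler_expR.
    rewrite subr_le0 (@le_trans _ _ 0)//.
      rewrite oppr_le0 mulr_ge0 ?step_cost_ge0//.
      by apply: sumr_ge0 => k _; exact: sqr_ge0.
    rewrite mulr_ge0 ?sqr_ge0// /step_weight divr_ge0//.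
      rewrite subr_ge0 laplace_sol0 divr1 add0r laplace_sol_ge1//.
      exact: ltW.
    by rewrite !mulr_ge0 ?expR_ge0// ltW// step_var_gt0.
under eq_cvg do rewrite fE.
by move=> h; apply: (cvg_unique _ h); [exact: ereal_hausdorff|exact: cvg_cst].
Qed.

End bridge_laplace.

(** * The Ito integral of the bridge *)

Section quadratic_variation.
Context {R : realType}.
Variables (T : R) (T0 : 0 < T) (T1 : T < 1).
Local Notation L := (log_horizon T).

(** The transform of the sum of the squared innovations tends to that of the
    constant L: (1 + z) ^ (- (n + 1) / 2) is an exponential of
    - (n + 1) ln (1 + z) / 2, with (n + 1) z / 2 tending to s L, and
    z / (1 + z) <= ln (1 + z) <= z. *)
Lemma cvg_sum_sqr_laplace (s : R) : 0 <= s ->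
  (Num.sqrt (1 + 2 * s * step_var (mesh T n)))^-1 ^+ n.+1 @[n --> \oo]
  --> expR (- (s * L)).
Proof.
move=> s0; pose z n := 2 * s * step_var (mesh T n).
have v0 n := step_var_gt0 (mesh_gt0 T0 T1 n).
have z0 n : 0 <= z n by rewrite mulr_ge0 ?(ltW (v0 n))// mulr_ge0.
have z1 n : 0 < 1 + z n by rewrite ltr_wpDr.
rewrite (_ : (fun n => _) = (fun n => expR (- (n.+1%:R * ln (1 + z n) / 2)))); last first.
  apply/funext => n; rewrite -/(z n).
  have {1}-> : 1 + z n = expR (ln (1 + z n) / 2) ^+ 2.
    by rewrite -expRM_natl mulrC divfK// lnK// posrE.
  rewrite sqrtr_sqr ger0_norm ?expR_ge0// -expRN -expRM_natl; congr expR.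
  by rewrite mulrN mulrA.
apply: continuous_cvg; first exact: continuous_expR.
apply: cvgN.
have nz : n.+1%:R * z n / 2 @[n --> \oo] --> s * L.
  rewrite (_ : (fun n => _) = (fun n => s * L * (step_var (mesh T n) / mesh T n))).
    by rewrite -[X in _ --> X]mulr1; apply: cvgMr; exact: cvg_step_var.
  apply/funext => n; rewrite /z -[in RHS](natM_mesh T n).
  have := mesh_gt0 T0 T1 n; move: (mesh T n) (step_var _) => dl v dl0.
  by field; rewrite gt_eqF.
have zc : z n @[n --> \oo] --> 0.
  rewrite (_ : (fun n => _) =
      (fun n => 2 * s * (step_var (mesh T n) / mesh T n * mesh T n))); last first.
    by apply/funext => n; rewrite /z divfK// gt_eqF// mesh_gt0.
  rewrite -[X in _ --> X](mulr0 (2 * s)); apply: cvgMr.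
  by rewrite -[X in _ --> X](mulr0 1); apply: cvgM; [exact: cvg_step_var|exact: cvg_mesh].
apply: (@squeeze_cvgr _ _ _ _ (fun n => n.+1%:R * z n / 2 * (1 + z n)^-1)
  (fun n => n.+1%:R * z n / 2)) => //.
- apply: nearW => n; rewrite mulrAC !ler_pM2r ?invr_gt0// -mulrA !ler_pM2l ?ltr0n//.
  apply/andP; split; last first.
    by apply: le_ln1Dx; apply: lt_le_trans (z0 n); exact: ltrN10.
  have := le_ln1Dx (x := - (z n / (1 + z n))).
  have -> : 1 + - (z n / (1 + z n)) = (1 + z n)^-1 by field; rewrite gt_eqF.
  rewrite lnV ?posrE// => /(_ _)/wrap[|h]; last by lra.
  by rewrite ltrN2 ltr_pdivrMr// mul1r ltrDr.
- rewrite -[X in _ --> X]mulr1; apply: cvgM => //.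
  have z1c : 1 + z n @[n --> \oo] --> (1 : R).
    by rewrite -[X in _ --> X]addr0; apply: cvgD => //; exact: cvg_cst.
  by rewrite -[X in _ --> X](invr1 R); apply: cvgV => //; exact: oner_neq0.
Qed.

End quadratic_variation.

Section ito_grid.
Context {R : realType}.
Variables (T : R) (T0 : 0 < T) (T1 : T < 1).

Definition grid_partition n : seq R := mkseq (fun k => grid (mesh T n) k.+1) n.+1.

Lemma nth_grid_partition n k : (k <= n.+1)%N ->
  nth T (0 :: grid_partition n) k = grid (mesh T n) k.
Proof.
by case: k => [|k] kn /=; rewrite ?grid0// nth_mkseq.
Qed.

Lemma grid_partitionP n : itv_partition 0 T (grid_partition n).
Proof.
split.
  have -> : path <%R 0 (grid_partition n) =
      sorted <%R (map (grid (mesh T n)) (iota 0 n.+2)).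
    have -> : iota 0 n.+2 = 0%N :: map succn (iota 0 n.+1).
      by rewrite -(iotaDl 1 0).
    by rewrite map_cons -map_comp grid0.
  apply: (homo_sorted (e := ltn)); last exact: iota_ltn_sorted.
  by move=> i j; apply: ltr_grid; exact: mesh_gt0.
rewrite -nth_last size_mkseq nth_mkseq//= grid_mesh//.
Qed.

Lemma ito_sum_grid d (Om : measurableType d) (H X : R -> Om -> R) n w :
  ito_sum T H X (grid_partition n) w =
  \sum_(0 <= k < n.+1) H (grid (mesh T n) k) w *
    (X (grid (mesh T n) k.+1) w - X (grid (mesh T n) k) w).
Proof.
rewrite /ito_sum size_mkseq big_nat_cond [RHS]big_nat_cond.
apply: eq_bigr => k /andP[/andP[_ kn] _].
by rewrite !nth_grid_partition// ltnW.
Qed.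

End ito_grid.

Section probability_limits.
Context {d : measure_display} {Om : measurableType d} {R : realType}
  (P : probability Om R).

(** Markov's inequality, in a form that allows any nonnegative test function
    bounded below on the events. *)
Lemma prob_cvg0 (f : nat -> Om -> R) (B : nat -> set Om) (c eta : R) :
  (forall n, measurable_fun setT (f n)) -> (forall n w, 0 <= f n w) ->
  (forall n, measurable (B n)) -> 0 < c -> 0 < eta ->
  (forall n w, B n w -> c <= f n w) ->
  (\int[P]_w (f n w)%:E @[n --> \oo] --> 0%E)%E ->
  \forall n \near \oo, (P (B n) < eta%:E)%E.
Proof.
move=> mf f0 mB c0 eta0 Bf fcvg.
have ce0 : 0 < c * eta by rewrite mulr_gt0.
have : \forall n \near \oo, (\int[P]_w (f n w)%:E < (c * eta)%:E)%E.
  have ce : (0%:E < (c * eta)%:E)%E by rewrite lte_fin.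
  exact: (fcvg _ (open_ereal_lt' ce)).
apply: filterS => n; apply: contraTT; rewrite -!leNgt => h.
apply: (@le_trans _ _ (c%:E * P (B n))%E).
  by rewrite EFinM lee_pmul2l// lte_fin.
rewrite -integral_cst//.
apply: (@le_trans _ _ (\int[P]_(w in B n) (f n w)%:E)%E).
  apply: ge0_le_integral => //.
  - by move=> w Bw; rewrite lee_fin ltW.
  - by apply/measurable_EFinP; exact: measurable_funTS.
  - by move=> w Bw; rewrite lee_fin Bf.
by apply: ge0_subset_integral => //; [exact/measurable_EFinP|move=> w _; rewrite lee_fin].
Qed.

End probability_limits.

Section ito_identification.
Context {d : measure_display} {Om : measurableType d} {R : realType}
  (P : probability Om R).
Variables (a T : R) (a0 : 0 <= a) (T0 : 0 < T) (T1 : T < 1).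
Variables (W X : R -> {RV P >-> R}).
Hypotheses (W_bm : brownian_motion01 W) (X_bridge : alpha_brownian_bridge a W X).
Local Notation L := (log_horizon T).

Let path (Z : R -> {RV P >-> R}) w t := Z t w.

Let sumsq n w := \sum_(0 <= k < n.+1) innov (path W w) (mesh T n) k ^+ 2.

Let measurable_sumsq n : measurable_fun setT (sumsq n).
Proof.
apply: measurable_sum => k; apply: measurable_funX; exact: measurable_innov.
Qed.

(** Convergence of exp (- S) in L2 to exp (- L), where S is the sum of the
    squared innovations: expanding the square only involves the transform of S
    at 1 and 2. Convergence of S in probability follows without any moment of
    S. *)
Lemma cvg_sumsq_L2 :
  (\int[P]_w ((expR (- sumsq n w) - expR (- L)) ^+ 2)%:E @[n --> \oo] --> 0%E)%E.
Proof.
pose q s n := (Num.sqrt (1 + 2 * s * step_var (mesh T n)))^-1 ^+ n.+1.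
have qE s n : 0 <= s -> (\int[P]_w (expR (- (s * sumsq n w)))%:E = (q s n)%:E)%E.
  by move=> s0; have := laplace_bm_sqr W_bm (mesh_gt0 T0 T1 n) n.+1 s0.
have mE s n : measurable_fun setT (fun w => expR (- (s * sumsq n w))).
  by apply: measurableT_comp => //; apply: measurableT_comp => //; exact: measurable_funM.
have E n : (\int[P]_w ((expR (- sumsq n w) - expR (- L)) ^+ 2)%:E =
    (q 2 n + expR (- (2 * L)) - 2 * expR (- L) * q 1 n)%:E)%E.
  have m1 : measurable_fun setT (fun w => (expR (- sumsq n w) - expR (- L)) ^+ 2).
    apply: measurable_funX; apply: measurable_funB => //.
    by apply: measurableT_comp => //; exact: measurableT_comp.
  have e2 : expR (- (2 * L)) = expR (- L) ^+ 2 by rewrite -expRM_natl; congr expR; ring.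
  have : (\int[P]_w ((expR (- sumsq n w) - expR (- L)) ^+ 2)%:E +
      \int[P]_w ((2 * expR (- L))%:E * (expR (- (1 * sumsq n w)))%:E) =
      \int[P]_w ((expR (- (2 * sumsq n w)))%:E + (expR (- (2 * L)))%:E))%E.
    have m2 : measurable_fun setT
        (fun w => ((2 * expR (- L))%:E * (expR (- (1 * sumsq n w)))%:E)%E).
      by apply: emeasurable_funM => //; exact/measurable_EFinP.
    rewrite -ge0_integralD//; last 2 first.
    - by move=> w _; rewrite lee_fin sqr_ge0.
    - exact/measurable_EFinP.
    apply: eq_integral => w _; rewrite -EFinM -!EFinD e2; congr EFin.
    rewrite mul1r -mulrN expRM_natl; ring.
  rewrite ge0_integralD//; [|exact/measurable_EFinP].
  rewrite ge0_integralZl//; last exact/measurable_EFinP.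
  rewrite (qE 1 n ler01) (qE 2 n (ler0n R 2)) integral_cst//= probability_setT mule1 -EFinM -EFinD => h.
  by rewrite EFinB -h addeK.
under eq_cvg do rewrite E.
rewrite (_ : 0%E = (expR (- (2 * L)) + expR (- (2 * L))
  - 2 * expR (- L) * expR (- (1 * L)))%:E); last first.
  have -> : expR (- (2 * L)) = expR (- L) ^+ 2 by rewrite -expRM_natl; congr expR; ring.
  by rewrite mul1r; congr EFin; ring.
apply: cvg_EFin; first exact: nearW.
apply: cvgB; last by apply: cvgMr; exact: cvg_sum_sqr_laplace.
by apply: cvgD; [exact: cvg_sum_sqr_laplace|exact: cvg_cst].
Qed.

Let measurable_ito_grid n :
  measurable_fun setT (ito_sum T (fun s w => X s w / (1 - s)) X (grid_partition T n)).
Proof.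
rewrite (_ : ito_sum _ _ _ _ = fun w => \sum_(0 <= k < n.+1)
    X (grid (mesh T n) k) w / (1 - grid (mesh T n) k) *
    (X (grid (mesh T n) k.+1) w - X (grid (mesh T n) k) w)); last first.
  by apply/funext => w; rewrite ito_sum_grid.
apply: measurable_sum => k; apply: measurable_funM.
  exact: measurable_funM.
exact: measurable_funB.
Qed.

(** For a fine grid the difference between the two sides is the sum of three
    errors that are small in probability: the discrete Ito formula, the sum of
    the squared innovations, and the distance from the Ito sum to its limit.
    Since the difference does not depend on the grid, it vanishes almost
    surely. *)
Lemma ito_integral_bridge (I : {RV P >-> R}) :
  ito_integral T (fun s w => X s w / (1 - s)) X I ->
  {ae P, forall w, 2 * I w = bridge_terminal T X w - bridge_energy T X w - L}.
Proof.
move=> itoI.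
pose A n w := ito_sum T (fun s w => X s w / (1 - s)) X (grid_partition T n) w.
pose Q w := bridge_terminal T X w - bridge_energy T X w.
pose D w := Q w - 2 * I w - L.
pose r n w := Q w - (2 * A n w + sumsq n w).
have mQ : measurable_fun setT Q.
  apply: measurable_funB; first exact: measurable_bridge_terminal.
  exact: measurable_bridge_energy.
have mD : measurable_fun setT D.
  by apply: measurable_funB => //; apply: measurable_funB => //; exact: measurable_funM.
have mr n : measurable_fun setT (r n).
  apply: measurable_funB => //; apply: measurable_funD => //.
  apply: measurable_funM => //; exact: measurable_ito_grid.
have r0 : {ae P, forall w, r n w @[n --> \oo] --> 0}.
  apply: filterS2 X_bridge (bridge_energyE T0 T1 X_bridge) => w [cX X0 eqX] Ew.
  rewrite -(subrr (Q w)); apply: cvgB; first exact: cvg_cst.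
  under eq_cvg => n do rewrite /A ito_sum_grid.
  by rewrite /Q Ew; have := cvg_ito_energy a0 T0 T1 cX X0 eqX.
have mge (f : Om -> R) e : measurable_fun setT f ->
    measurable [set w | e <= `|f w|].
  move=> mf; have -> : [set w | e <= `|f w|] = (fun w => `|f w|) @^-1` `[e, +oo[.
    by apply/seteqP; split => w /=; rewrite in_itv /= andbT.
  have mnf : measurable_fun setT (fun w => `|f w|) by exact: measurableT_comp.
  by rewrite -[X in measurable X]setTI; apply: mnf.
have null e : 0 < e -> P [set w | 3 * e <= `|D w|] = 0%E.
  move=> e0; apply/eqP; rewrite eq_le measure_ge0 andbT.
  apply/lee_addgt0Pr => eta eta0; rewrite add0e.
  have [delta delta0 Adelta] := itoI (e / 2) (eta / 3) (divr_gt0 e0 (ltr0n _ 2))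
    (divr_gt0 eta0 (ltr0n _ 3)).
  have near_r : \forall n \near \oo, (P [set w | (e <= `|r n w|)%R] < (eta / 3)%:E)%E.
    (* almost sure convergence is tested on a bounded function of r *)
    apply: (@prob_cvg0 _ _ _ P (fun n w => 1 - expR (- `|r n w|)) _
      (1 - expR (- e))).
    - move=> n; apply: measurable_funB => //; apply: measurableT_comp => //.
      by apply: measurableT_comp => //; exact: measurableT_comp.
    - by move=> n w; rewrite subr_ge0 -expR0 ler_expR oppr_le0.
    - by move=> n; exact: mge.
    - by rewrite subr_gt0 -expR0 ltr_expR oppr_lt0.
    - by rewrite divr_gt0.
    - by move=> n w /= er; rewrite lerD2l lerN2 ler_expR lerN2.
    have -> : 0%E = (\int[P]_w (0 : R)%:E)%E by rewrite integral0.
    apply: bounded_convergence_prob => //.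
    - move=> n; apply: measurable_funB => //; apply: measurableT_comp => //.
      by apply: measurableT_comp => //; exact: measurableT_comp.
    - apply: filterS r0 => w rw; rewrite -[X in _ --> X](subrr 1); apply: cvgB.
        exact: cvg_cst.
      rewrite -[X in _ --> X]expR0; apply: continuous_cvg.
        exact: continuous_expR.
      by rewrite -[X in _ --> X]oppr0; apply: cvgN; rewrite -[X in _ --> X](normr0 R); apply: cvg_norm.
    - move=> n w; have : expR (- `|r n w|) <= 1 by rewrite -expR0 ler_expR oppr_le0.
      have := expR_ge0 (- `|r n w|).
      by move=> h1 h2; rewrite ger0_norm; lra.
  have near_S : \forall n \near \oo,
      (P [set w | (e <= `|sumsq n w - L|)%R] < (eta / 3)%:E)%E.
    apply: (@prob_cvg0 _ _ _ P (fun n w => (expR (- sumsq n w) - expR (- L)) ^+ 2) _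
      ((expR (- L) * (1 - expR (- e))) ^+ 2)).
    - move=> n; apply: measurable_funX; apply: measurable_funB => //.
      by apply: measurableT_comp => //; exact: measurableT_comp.
    - by move=> n w; exact: sqr_ge0.
    - by move=> n; apply: mge; exact: measurable_funB.
    - by rewrite exprn_gt0// mulr_gt0 ?expR_gt0// subr_gt0 -expR0 ltr_expR oppr_lt0.
    - by rewrite divr_gt0.
    - move=> n w /=; set S := sumsq n w.
      have ee : expR (- e) <= 1 by rewrite -expR0 ler_expR oppr_le0 ltW.
      have c0 : 0 <= expR (- L) * (1 - expR (- e)).
        by rewrite mulr_ge0 ?expR_ge0// subr_ge0.
      rewrite ler_normr => /orP[h|h].
        have : expR (- S) <= expR (- L) * expR (- e).
          by rewrite -expRD ler_expR; lra.
        have := expR_ge0 (- L); nra.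
      have : expR (- L) * expR e <= expR (- S) by rewrite -expRD ler_expR; lra.
      have : expR (- L) * (1 - expR (- e)) <= expR (- L) * (expR e - 1).
        apply: ler_wpM2l; first exact: expR_ge0.
        by have := expR_ge1Dx e; have := expR_ge1Dx (- e); lra.
      by move=> h1 h2; rewrite ler_sqr ?nnegrE//; lra.
    exact: cvg_sumsq_L2.
  have near_m : \forall n \near \oo, mesh T n < delta.
    have /cvgrPdist_lt /(_ _ delta0) := @cvg_mesh R T.
    by apply: filterS => n; rewrite sub0r normrN; apply: le_lt_trans; exact: ler_norm.
  have [n [[hr hS] hm]] := filter_ex (filterI (filterI near_r near_S) near_m).
  have hA := Adelta _ (grid_partitionP T0 T1 n) _.
  have {hA} := hA _.
  rewrite size_mkseq => /(_ _)/wrap[i|hA].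
    move=> ni; rewrite !nth_grid_partition//; last exact: ltnW.
    by apply: le_lt_trans hm; apply: gridS_sub; exact/ltW/mesh_gt0.
  apply: (@le_trans _ _ (P ([set w | (e <= `|r n w|)%R]
      `|` [set w | (e <= `|sumsq n w - L|)%R]
      `|` [set w | (e / 2 <= `|A n w - I w|)%R]))%E).
    apply: le_measure; rewrite ?inE//; first exact: mge.
      apply: measurableU; first by apply: measurableU; apply: mge => //; exact: measurable_funB.
      by apply: mge; apply: measurable_funB => //; exact: measurable_ito_grid.
    move=> w /= Dw; apply: contrapT => /not_orP[/not_orP[/negP + /negP +] /negP].
    rewrite -!ltNge => h1 h2 h3; move: Dw; apply/negP; rewrite -ltNge.
    have -> : D w = r n w + (sumsq n w - L) + 2 * (A n w - I w).
      by rewrite /D /r; ring.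
    rewrite (le_lt_trans (ler_normD _ _))// normrM (ger0_norm (ler0n _ 2)).
    have := ler_normD (r n w) (sumsq n w - L); lra.
  apply: le_trans (measureU2 _ _ _) _ => //.
    by apply: measurableU; apply: mge => //; exact: measurable_funB.
    by apply: mge; apply: measurable_funB => //; exact: measurable_ito_grid.
  apply: (@le_trans _ _ ((eta / 3)%:E + (eta / 3)%:E + (eta / 3)%:E)%E); last first.
    by rewrite -!EFinD lee_fin; lra.
  apply: leeD; last exact: ltW.
  apply: le_trans (measureU2 _ _ _) _; [exact: mge|by apply: mge; exact: measurable_funB|].
  by apply: leeD; exact: ltW.
have : {ae P, forall w, forall k, `|D w| < k.+1%:R^-1}.
  apply/ae_foralln => k; exists [set w | 3 * (k.+1%:R^-1 / 3) <= `|D w|]; split.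
  - exact: mge.
  - by apply: null; rewrite divr_gt0.
  - by move=> w /= /negP; rewrite -leNgt mulrC divfK.
apply: filterS => w Dw; have : D w = 0.
  apply/eqP; rewrite -normr_eq0 eq_le normr_ge0 andbT leNgt; apply/negP => Dw0.
  have [k] := ltr_add_invr Dw0; rewrite add0r => /(lt_trans (Dw k)).
  by rewrite ltxx.
by rewrite /D -/(Q w); lra.
Qed.

End ito_identification.

(** * Lebesgue integrals on half-lines *)

Section lebesgue_complements.
Context {R : realType}.
Local Notation mu := (@lebesgue_measure R).

(** The inverse is not continuous at 0, but it is x times a real power of
    x ^ 2, also at 0 where both vanish. *)
Lemma measurable_funV d (Om : measurableType d) (f : Om -> R) :
  measurable_fun setT f -> measurable_fun setT (fun x => (f x)^-1).
Proof.
move=> mf; rewrite (_ : (fun x => _) = fun x => f x * (f x ^+ 2) `^ (- 1)).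
  apply: measurable_funM => //.
  by apply: (measurableT_comp (measurable_powR _)); exact: measurable_funX.
apply/funext => x; rewrite powR_inv1 ?sqr_ge0//.
have [->|fx0] := eqVneq (f x) 0; first by rewrite mul0r invr0.
by field.
Qed.

(** The positive and negative parts are exchanged by the reflection, which
    preserves the Lebesgue measure. *)
Lemma integral_odd_segment (f : R -> R) (r : R) :
  mu.-integrable `[- r, r] (EFin \o f) -> measurable_fun setT f ->
  (forall x, f (- x) = - f x) ->
  \int[mu]_(x in `[- r, r]) f x = 0.
Proof.
move=> intf mf oddf; rewrite /Rintegral integralE.
have sym : `[- r, r]%classic = (-%R : R -> measurableTypeR R) @^-1` `[- r, r].
  by apply/seteqP; split => x; rewrite /= !in_itv /= => /andP[h1 h2];
    apply/andP; split; lra.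
have negE : (\int[mu]_(x in `[(- r)%R, r]) (EFin \o f)^\- x =
    \int[mu]_(x in `[(- r)%R, r]) (EFin \o f)^\+ x)%E.
  have mfp : measurable_fun setT ((EFin \o f)^\+)%E.
    by apply: measurable_funepos; exact/measurable_EFinP.
  transitivity (\int[pushforward mu (-%R : _ -> measurableTypeR R)]_(x in `[(- r)%R, r])
      (EFin \o f)^\+ x)%E; last first.
    by apply: eq_measure_integral => //= A mA _; exact: lebesgue_measureN.
  rewrite ge0_integral_pushforward//=; last exact: measurable_funS mfp.
  rewrite -sym; apply: eq_integral => x _ /=.
  by rewrite funenegE funeposE /= oddf EFinN.
rewrite negE subee//.
by have := integrable_pos_fin_num _ intf; apply.
Qed.

(** For t < 0 the integral over [t, - t] vanishes. *)
Lemma Rintegral_odd_tail (f : R -> R) (t : R) :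
  mu.-integrable `[t, +oo[ (EFin \o f) -> measurable_fun setT f ->
  (forall x, f (- x) = - f x) ->
  \int[mu]_(x in `[t, +oo[) f x = \int[mu]_(x in `[`|t|, +oo[) f x.
Proof.
move=> intf mf oddf; have [t0|t0] := leP 0 t; first by rewrite ger0_norm.
rewrite ltr0_norm//.
have tt : t <= - t by rewrite (le_trans (ltW t0))// oppr_ge0 ltW.
have := @Rintegral_itvB R f (BLeft t) +oo%O (- t) intf.
rewrite !bnd_simp => /(_ tt isT).
rewrite Rintegral_itv_obnd_cbnd; last first.
  by apply: integrableS intf => //; apply: subset_itvr; rewrite bnd_simp.
have i1 : mu.-integrable `[t, - t] (EFin \o f).
  by apply: integrableS intf => //; exact: subset_itvl.
have := @integral_odd_segment f (- t); rewrite opprK => -> //.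
by rewrite subr0.
Qed.

Lemma integral_expR_tail (q q' : R -> R) (t : R) :
  (forall u : R, is_derive u 1 q (q' u)) -> continuous q' ->
  (forall u, t <= u -> 0 <= q' u) -> q u @[u --> +oo] --> +oo ->
  (\int[mu]_(u in `[t, +oo[) (q' u * expR (- q u))%:E = (expR (- q t))%:E)%E.
Proof.
move=> dq cq' q'0 qoo.
pose F (u : R) := - expR (- q u).
have dF : forall u : R, is_derive u 1 F (q' u * expR (- q u)).
  move=> u; have d1 := is_deriveN (dq u).
  have := is_deriveN (@is_derive1_comp _ (@expR R) (- q) u _ _ (is_derive_expR _) d1).
  by rewrite mulrN opprK mulrC.
have cF : forall u : R, {for u, continuous F}.
  by move=> u; have [h _] := dF u; apply/differentiable_continuous/derivable1_diffP.
have cq : continuous q.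
  by move=> u; have [h _] := dq u; apply/differentiable_continuous/derivable1_diffP.
rewrite (@ge0_continuous_FTC2y _ _ F t 0).
- by rewrite /F -EFinB sub0r opprK.
- by move=> u tu; rewrite mulr_ge0 ?expR_ge0// q'0.
- apply: continuous_subspaceT => u; apply: cvgM; first exact: cq'.
  apply: (@continuous_comp _ _ _ (fun u => - q u) (@expR R)); last exact: continuous_expR.
  by apply: cvgN; exact: cq.
- rewrite -oppr0; apply: cvgN.
  exact: (cvg_comp _ _ qoo (@cvgr_expR R)).
- by move=> u _; have [] := dF u.
- by apply: cvg_at_right_filter; exact: cF.
- by move=> u _; rewrite derive1E; have [_ ->] := dF u.
Qed.

Lemma integrable_expR_tail (k t : R) : 0 < k ->
  mu.-integrable `[t, +oo[ (EFin \o (fun u => expR (- (k * u)))).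
Proof.
move=> k0; apply/integrableP; split.
  apply/measurable_EFinP; apply: measurable_funTS.
  by apply: measurableT_comp => //; apply: measurableT_comp => //; exact: measurable_funM.
have mk : measurable_fun `[t, +oo[ (fun u : R => (k * expR (- (k * u)))%:E).
  apply/measurable_EFinP; apply: measurable_funTS; apply: measurable_funM => //.
  by apply: measurableT_comp => //; apply: measurableT_comp => //; exact: measurable_funM.
have E : (\int[mu]_(u in `[t, +oo[) (k * expR (- (k * u)))%:E
    = (expR (- (k * t)))%:E)%E.
  apply: (@integral_expR_tail (fun u => k * u) (fun=> k)).
  - move=> u; have := is_deriveZ k (is_derive_id u (1 : R)).
    by rewrite /GRing.scale /= mulr1.
  - by move=> u; exact: cvg_cst.
  - by move=> u _; exact: ltW.
  - exact: gt0_cvgMry.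
under eq_integral => u _ do rewrite /= ger0_norm ?expR_ge0//
  -[expR _]mul1r -(mulVf (lt0r_neq0 k0)) -mulrA EFinM.
rewrite ge0_integralZl//.
- by rewrite E -EFinM ltry.
- by move=> u _; rewrite lee_fin mulr_ge0 ?expR_ge0// ltW.
- by rewrite lee_fin invr_ge0 ltW.
Qed.

End lebesgue_complements.

(** * The two integrands *)

Section integrands.
Context {R : realType}.
Local Notation mu := (@lebesgue_measure R).
Variables (a T : R) (T0 : 0 < T) (T1 : T < 1).
Local Notation L := (log_horizon T).
Local Notation th := (1 / 2 - a).

(** [denom], [integrand_terminal] and [integrand_energy] are the expressions
    under the integrals of the final formula; up to a constant the last two are
    u times the expectations of Q exp (- (u ^ 2 - th ^ 2) / 2 J) and of
    exp (- (u ^ 2 - th ^ 2) / 2 J). *)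
Definition denom (u : R) : R :=
  (1 + (1 - 2 * a) / (2 * u)) * (1 - T) `^ u
  + (1 - (1 - 2 * a) / (2 * u)) * (1 - T) `^ (- u).

Definition integrand_terminal (u : R) : R :=
  ((1 - T) `^ u - (1 - T) `^ (- u)) / denom u `^ (3 / 2).

Definition integrand_energy (u : R) : R := u / Num.sqrt (denom u).

Let L0 : 0 < L := log_horizon_gt0 T0 T1.

Lemma powR_horizon u : (1 - T) `^ u = expR (- (u * L)).
Proof. by rewrite /powR gt_eqF ?subr_gt0// /log_horizon mulrN opprK. Qed.

Lemma denomE u : denom u =
  (1 + th / u) * expR (- (u * L)) + (1 - th / u) * expR (u * L).
Proof.
rewrite /denom !powR_horizon mulNr opprK.
have -> : (1 - 2 * a) / (2 * u) = th / u.
  by rewrite invfM mulrA; congr (_ / _); field.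
by [].
Qed.

Lemma laplace_sol_denom u : laplace_sol th u 0 L = expR (th * L) * denom u / 2.
Proof.
rewrite denomE /laplace_sol mulr0 sub0r mulNr opprK.
have -> : expR ((u + th) * L) = expR (th * L) * expR (u * L).
  by rewrite -expRD; congr expR; ring.
have -> : expR ((th - u) * L) = expR (th * L) * expR (- (u * L)).
  by rewrite -expRD; congr expR; ring.
ring.
Qed.

Definition denom_bound : R := expR (- (4 * `|th| * L)) / 2.

Lemma denom_bound_gt0 : 0 < denom_bound.
Proof. by rewrite divr_gt0 ?expR_gt0. Qed.

(** For u > 0 with u >= 2 th the coefficient 1 - th / u of exp (u L) is at
    least 1 / 2. For th <= u < 2 th it may vanish, and the other exponential takes over: on
    this bounded range the two differ by a factor at most exp (4 |th| L), which
    is where the constant comes from. For u < 0, necessarily th < 0 and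
    exp (- u L), with coefficient 1 + th / u >= 1, is the larger one. *)
Lemma denom_ge u : th <= u -> denom_bound * expR (`|u| * L) <= denom u.
Proof.
move=> thu; rewrite denomE.
have h4 : expR (- (4 * `|th| * L)) <= 1.
  by rewrite -expR0 ler_expR oppr_le0 !mulr_ge0// ltW.
have db : denom_bound <= 1 / 2 by rewrite /denom_bound ler_pM2r.
have db0 := ltW denom_bound_gt0.
have e1 := expR_gt0 (u * L); have e2 := expR_gt0 (- (u * L)).
have [u0|u0|->] := ltgtP u 0; last first.
- rewrite invr0 mulr0 !mul0r oppr0 normr0 mul0r expR0; lra.
- rewrite gtr0_norm//.
  have le12 : expR (- (u * L)) <= expR (u * L).
    by rewrite ler_expR; have := mulr_gt0 u0 L0; lra.
  have [th0|th0] := leP 0 th; last first.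
    have t0 : th / u <= 0 by rewrite ler_pdivrMr// mul0r ltW.
    nra.
  have t1 : th / u <= 1 by rewrite ler_pdivrMr//; lra.
  have t0 : 0 <= th / u by rewrite divr_ge0// ltW.
  have [h|h] := leP (2 * th) u.
    have t2 : th / u <= 1 / 2 by rewrite ler_pdivrMr//; lra.
    nra.
  have e3 : expR (- (4 * `|th| * L)) * expR (u * L) <= expR (- (u * L)).
    rewrite -expRD ler_expR (ger0_norm th0).
    have : u * L < 2 * th * L by rewrite ltr_pM2r.
    lra.
  rewrite /denom_bound; nra.
- rewrite ltr0_norm// mulNr.
  have le12 : expR (u * L) <= expR (- (u * L)).
    by rewrite ler_expR; have := nmulr_rlt0 L u0; rewrite L0; lra.
  have th0 : th < 0 by exact: le_lt_trans u0.
  have t0 : 0 <= th / u by rewrite ler_ndivlMr// mul0r ltW.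
  nra.
Qed.

Lemma measurable_denom : measurable_fun setT denom.
Proof.
have mp : measurable_fun setT (fun u : R => (1 - T) `^ u) by exact: measurable_powRr.
have mi : measurable_fun setT (fun u : R => (1 - 2 * a) / (2 * u)).
  by apply: measurable_funM => //; apply: measurable_funV; exact: measurable_funM.
apply: measurable_funD; apply: measurable_funM => //.
- exact: measurable_funD.
- exact: measurable_funB.
- by apply: (measurableT_comp (measurable_powRr _)).
Qed.

Lemma measurable_sqrt_denom : measurable_fun setT (fun u => Num.sqrt (denom u)).
Proof.
apply: (measurableT_comp (f := @Num.sqrt R)); last exact: measurable_denom.
exact: continuous_measurable_fun (@sqrt_continuous R).
Qed.

Lemma measurable_integrand_energy : measurable_fun setT integrand_energy.
Proof.
by apply: measurable_funM => //; apply: measurable_funV; exact: measurable_sqrt_denom.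
Qed.

Lemma measurable_integrand_terminal : measurable_fun setT integrand_terminal.
Proof.
apply: measurable_funM.
  apply: measurable_funB; first exact: measurable_powRr.
  exact: (measurableT_comp (measurable_powRr _)).
apply: measurable_funV; apply: (measurableT_comp (measurable_powR _)).
exact: measurable_denom.
Qed.

Lemma denomN u : denom (- u) = denom u.
Proof.
by rewrite !denomE invrN !mulrN mulNr !opprK addrC.
Qed.

Lemma integrand_energyN u : integrand_energy (- u) = - integrand_energy u.
Proof. by rewrite /integrand_energy denomN mulNr. Qed.

Lemma integrand_terminalN u : integrand_terminal (- u) = - integrand_terminal u.
Proof. by rewrite /integrand_terminal denomN opprK -mulNr opprB. Qed.

Lemma powR32 (x : R) : 0 < x -> x `^ (3 / 2) = Num.sqrt x ^+ 3.
Proof.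
move=> x0; have -> : (3 / 2 : R) = 1 + 2^-1 by field.
rewrite powRD; last by rewrite gt_eqF// implybT.
by rewrite powRr1 ?(ltW x0)// powR12_sqrt ?(ltW x0)// exprSr sqr_sqrtr// ltW.
Qed.

Let sqrt_denom_ge u : th <= u ->
  Num.sqrt denom_bound * expR (`|u| * L / 2) <= Num.sqrt (denom u).
Proof.
move=> /denom_ge h.
have -> : expR (`|u| * L / 2) = Num.sqrt (expR (`|u| * L)).
  rewrite -[in RHS](_ : expR (`|u| * L / 2) ^+ 2 = expR (`|u| * L)).
    by rewrite sqrtr_sqr [RHS]ger0_norm ?expR_ge0.
  by rewrite -expRM_natl; congr expR; field.
by rewrite -sqrtrM ?(ltW denom_bound_gt0)//; exact: ler_wsqrtr.
Qed.

Lemma denom_gt0 u : th <= u -> 0 < denom u.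
Proof.
by move=> /denom_ge; apply: lt_le_trans; rewrite mulr_gt0 ?denom_bound_gt0 ?expR_gt0.
Qed.

Let expR_abs_tail u (c : R) : 1 / 4 <= c ->
  expR (- (c * (`|u| * L))) <= expR (- (L / 4 * u)).
Proof.
move=> c4; rewrite ler_expR lerN2.
have h1 : u * L <= `|u| * L by rewrite ler_pM2r// ler_norm.
have h2 : 0 <= `|u| * L by rewrite mulr_ge0// ltW.
nra.
Qed.

(** The square root of [denom] grows as exp (|u| L / 2); half of this growth
    absorbs the factor u, and the other half dominates exp (u L / 4). *)
Lemma integrable_integrand_energy t : th <= t ->
  mu.-integrable `[t, +oo[ (EFin \o integrand_energy).
Proof.
move=> tht; pose C := 4 / L / Num.sqrt denom_bound.
have sd0 : 0 < Num.sqrt denom_bound by rewrite sqrtr_gt0 denom_bound_gt0.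
have C0 : 0 < C by rewrite !divr_gt0.
apply: (@le_integrable _ _ _ mu _ _ _
  (fun u => C%:E * (expR (- (L / 4 * u)))%:E)%E) => //.
- by apply/measurable_EFinP; apply: measurable_funTS; exact: measurable_integrand_energy.
- move=> u /=; rewrite in_itv /= andbT => tu; have thu := le_trans tht tu.
  have s0 : 0 < Num.sqrt (denom u) by rewrite sqrtr_gt0 denom_gt0.
  rewrite lee_fin normrM normfV (gtr0_norm s0).
  rewrite [leRHS](ger0_norm (mulr_ge0 (ltW C0) (expR_ge0 _))).
  rewrite ler_pdivrMr//.
  have h1 := sqrt_denom_ge thu.
  have h2 : `|u| <= 4 / L * expR (`|u| * L / 4).
    rewrite -ler_pdivrMl ?divr_gt0// invf_div.
    by have := expR_ge1Dx (`|u| * L / 4); lra.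
  have h3 : expR (`|u| * L / 4) = expR (- (1 / 4 * (`|u| * L))) * expR (`|u| * L / 2).
    by rewrite -expRD; congr expR; field.
  rewrite (le_trans h2)// h3 /C.
  have -> : 4 / L / Num.sqrt denom_bound * expR (- (L / 4 * u)) * Num.sqrt (denom u) =
    4 / L * (expR (- (L / 4 * u)) * (Num.sqrt (denom u) / Num.sqrt denom_bound)) by ring.
  rewrite ler_pM2l ?divr_gt0//; apply: ler_pM; rewrite ?expR_ge0//.
    by apply: expR_abs_tail; lra.
  by rewrite ler_pdivlMr// mulrC.
- have L40 : 0 < L / 4 by rewrite divr_gt0.
  exact: (integrableZl _ C (integrable_expR_tail t L40)).
Qed.

(** The numerator is at most exp (|u| L), and the denominator grows as its
    power 3 / 2. *)
Lemma integrable_integrand_terminal t : th <= t ->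
  mu.-integrable `[t, +oo[ (EFin \o integrand_terminal).
Proof.
move=> tht; pose C := (Num.sqrt denom_bound ^+ 3)^-1.
have sd0 : 0 < Num.sqrt denom_bound by rewrite sqrtr_gt0 denom_bound_gt0.
have C0 : 0 < C by rewrite invr_gt0 exprn_gt0.
apply: (@le_integrable _ _ _ mu _ _ _
  (fun u => C%:E * (expR (- (L / 4 * u)))%:E)%E) => //.
- by apply/measurable_EFinP; apply: measurable_funTS; exact: measurable_integrand_terminal.
- move=> u /=; rewrite in_itv /= andbT => tu; have thu := le_trans tht tu.
  have s0 : 0 < Num.sqrt (denom u) by rewrite sqrtr_gt0 denom_gt0.
  rewrite lee_fin /integrand_terminal powR32 ?denom_gt0// normrM normfV.
  rewrite (gtr0_norm (exprn_gt0 3 s0)).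
  rewrite [leRHS](ger0_norm (mulr_ge0 (ltW C0) (expR_ge0 _))).
  rewrite ler_pdivrMr ?exprn_gt0// !powR_horizon mulNr opprK.
  have h1 := sqrt_denom_ge thu.
  have h2 : `|expR (- (u * L)) - expR (u * L)| <= expR (`|u| * L).
    have := expR_ge0 (- (u * L)); have := expR_ge0 (u * L).
    have [u0|u0] := leP 0 u.
      have le12 : expR (- (u * L)) <= expR (u * L).
        by rewrite ler_expR; have := mulr_ge0 u0 (ltW L0); lra.
      by move=> *; rewrite (ger0_norm u0) ler0_norm ?subr_le0//; lra.
    have le12 : expR (u * L) <= expR (- (u * L)).
      by rewrite ler_expR; have := nmulr_rlt0 L u0; rewrite L0; lra.
    by move=> *; rewrite (ltr0_norm u0) mulNr ger0_norm ?subr_ge0//; lra.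
  have h3 : expR (`|u| * L) = expR (- (1 / 2 * (`|u| * L))) * expR (`|u| * L / 2) ^+ 3.
    by rewrite -expRM_natl -expRD; congr expR; field.
  rewrite (le_trans h2)// h3 /C.
  have -> : (Num.sqrt denom_bound ^+ 3)^-1 * expR (- (L / 4 * u)) * Num.sqrt (denom u) ^+ 3 =
    expR (- (L / 4 * u)) * (Num.sqrt (denom u) / Num.sqrt denom_bound) ^+ 3.
    by rewrite exprMn exprVn; ring.
  rewrite ler_pM ?expR_ge0 ?exprn_ge0 ?expR_ge0//.
    by apply: expR_abs_tail; lra.
  by rewrite lerXn2r ?nnegrE ?expR_ge0 ?divr_ge0 ?sqrtr_ge0// ler_pdivlMr// mulrC.
- have L40 : 0 < L / 4 by rewrite divr_gt0.
  exact: (integrableZl _ C (integrable_expR_tail t L40)).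
Qed.

End integrands.

(** * Moments weighted by the inverse of the energy *)

Section moments.
Context {d : measure_display} {Om : measurableType d} {R : realType}
  (P : probability Om R).
Variables (a T : R) (a0 : 0 <= a) (T0 : 0 < T) (T1 : T < 1).
Variables (W X : R -> {RV P >-> R}).
Hypotheses (W_bm : brownian_motion01 W) (X_bridge : alpha_brownian_bridge a W X).
Local Notation L := (log_horizon T).
Local Notation th := (1 / 2 - a).
Local Notation J := (bridge_energy T X).
Local Notation Q := (bridge_terminal T X).
Local Notation mu := (@lebesgue_measure R).

(** The parameter of the Laplace transform of the energy, reparametrized by
    u. *)
Definition energy_rate (u : R) : R := (u ^+ 2 - th ^+ 2) / 2.

Let mJ : measurable_fun setT J := measurable_bridge_energy T X.
Let mQ : measurable_fun setT Q := measurable_bridge_terminal T X.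
Let Q0 w : 0 <= Q w := bridge_terminal_ge0 T1 X w.

Let measurable_expJ c : measurable_fun setT (fun w => expR (- (c * J w))).
Proof.
apply: measurableT_comp => //; apply: measurableT_comp => //.
exact: measurable_funM.
Qed.

Lemma laplace_energy u : `|th| <= u -> 0 < u ->
  (\int[P]_w (expR (- (energy_rate u * J w)))%:E =
   (Num.sqrt (laplace_sol th u 0 L))^-1%:E)%E.
Proof.
move=> thu u0; have := bridge_laplace a0 T0 T1 W_bm X_bridge thu u0 (lexx 0).
under eq_integral do rewrite mul0r subr0.
move=> ->; rewrite sqrtrV// ltW// laplace_sol_gt0// ltW//.
exact: log_horizon_gt0.
Qed.

(** The derivative of [laplace_sol th u m L] in m, which is constant. *)
Definition laplace_slope (u : R) : R :=
  (expR ((u + th) * L) - expR ((th - u) * L)) / u.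

Lemma laplace_solE (u m : R) : u != 0 ->
  laplace_sol th u m L = laplace_sol th u 0 L + m * laplace_slope u.
Proof.
move=> u0; rewrite /laplace_sol /laplace_slope.
by move: (expR _) (expR _) => e1 e2; field.
Qed.

(** The difference quotients of the transform in m are taken along m = 2 ^ - n:
    (1 - exp (- q m)) / m increases to q along this sequence, which gives a
    monotone convergence instead of a domination. *)
Let dyadic n : R := (1 / 2) ^+ n.

Let dyadic_gt0 n : 0 < dyadic n.
Proof. by rewrite exprn_gt0. Qed.

Let cvg_dyadic : dyadic n @[n --> \oo] --> 0.
Proof. by apply: cvg_expr; rewrite ger0_norm//; lra. Qed.

Let approx q n : R := (1 - expR (- (q * dyadic n))) / dyadic n.

Let approx_ge0 q n : 0 <= q -> 0 <= approx q n.
Proof.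
move=> q0; rewrite divr_ge0 ?(ltW (dyadic_gt0 n))// subr_ge0 -expR0 ler_expR.
by rewrite oppr_le0 mulr_ge0// ltW.
Qed.

Let approx_nd q n : approx q n <= approx q n.+1.
Proof.
have dS : dyadic n.+1 = dyadic n / 2 by rewrite /dyadic exprS; field.
have E : expR (- (q * dyadic n)) = expR (- (q * dyadic n.+1)) ^+ 2.
  by rewrite -expRM_natl dS; congr expR; field.
rewrite /approx E dS.
have := dyadic_gt0 n; move: (dyadic n) (expR _) => h e h0.
rewrite ler_pdivrMr//.
have -> : (1 - e) / (h / 2) * h = 2 * (1 - e) by field; rewrite gt_eqF.
have := sqr_ge0 (1 - e); lra.
Qed.

Let approx_cvg q : approx q n @[n --> \oo] --> q.
Proof.
apply/cvgrPdist_le => e e0.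
have : q ^+ 2 * expR `|q| * dyadic n @[n --> \oo] --> 0.
  by rewrite -(mulr0 (q ^+ 2 * expR `|q|)); apply: cvgMr; exact: cvg_dyadic.
move=> /cvgrPdist_le /(_ e e0); apply: filterS => n.
rewrite sub0r normrN => /(le_trans (ler_norm _)) ne; apply: le_trans ne.
have h0 := dyadic_gt0 n; have h1 : dyadic n <= 1.
  by rewrite exprn_ile1//; lra.
have -> : q - approx q n =
    (expR (- (q * dyadic n)) - 1 - - (q * dyadic n)) / dyadic n.
  by rewrite /approx; field; rewrite gt_eqF.
rewrite normrM normfV (gtr0_norm h0) ler_pdivrMr//.
apply: le_trans (expR_taylor1_norm _) _.
rewrite normrN normrM (gtr0_norm h0) sqrrN exprMn.
have -> : q ^+ 2 * expR `|q| * dyadic n * dyadic n =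
  q ^+ 2 * dyadic n ^+ 2 * expR `|q| by ring.
apply: ler_wpM2l; first by rewrite mulr_ge0 ?sqr_ge0.
by rewrite ler_expR ler_piMr.
Qed.

(** Minus the derivative in m, at m = 0, of the joint transform
    (K + m G) ^ (- 1 / 2), where G is the slope of [laplace_sol]. *)
Lemma laplace_terminal u : `|th| <= u -> 0 < u ->
  (\int[P]_w (Q w * expR (- (energy_rate u * J w)))%:E =
   (laplace_slope u / 2 * (Num.sqrt (laplace_sol th u 0 L) ^+ 3)^-1)%:E)%E.
Proof.
move=> thu u0; have L0 := log_horizon_gt0 T0 T1.
set K := laplace_sol th u 0 L; set G := laplace_slope u.
have K0 : 0 < K by rewrite laplace_sol_gt0// ltW.
have G0 : 0 <= G.
  rewrite divr_ge0 ?(ltW u0)// subr_ge0 ler_expR ler_pM2r//; lra.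
pose f n w := (approx (Q w) n * expR (- (energy_rate u * J w)))%:E.
have mexpQ n : measurable_fun setT (fun w => expR (- (Q w * dyadic n))).
  by apply: measurableT_comp => //; apply: measurableT_comp => //; exact: measurable_funM.
have mf n : measurable_fun setT (f n).
  apply/measurable_EFinP; apply: measurable_funM; last exact: measurable_expJ.
  by apply: measurable_funM => //; exact: measurable_funB.
have f0 n w : (0 <= f n w)%E by rewrite lee_fin mulr_ge0 ?approx_ge0 ?expR_ge0.
have fnd w : {homo f^~ w : n m / (n <= m)%N >-> (n <= m)%E}.
  apply/nondecreasing_seqP => n; rewrite lee_fin.
  by apply: ler_wpM2r; [exact: expR_ge0|exact: approx_nd].
have := @cvg_monotone_convergence _ _ _ P setT measurableT f mf
  (fun n w _ => f0 n w) (fun w _ => fnd w).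
have flim w : limn (f ^~ w) = (Q w * expR (- (energy_rate u * J w)))%:E.
  apply/cvg_lim => //; apply: cvg_EFin; first exact: nearW.
  by apply: cvgM; [exact: approx_cvg|exact: cvg_cst].
under [X in _ --> X -> _]eq_integral do rewrite flim.
have fE n : (\int[P]_w f n w = (((Num.sqrt K)^-1
    - (Num.sqrt (K + dyadic n * G))^-1) / dyadic n)%:E)%E.
  have h0 := dyadic_gt0 n.
  have E1 := laplace_energy thu u0.
  have := bridge_laplace a0 T0 T1 W_bm X_bridge thu u0 (ltW h0).
  rewrite laplace_solE ?gt_eqF// -/K -/G => E2.
  set e1 := fun w => (expR (- (energy_rate u * J w)))%:E in E1.
  set e2 := fun w => (expR (- (energy_rate u * J w) - dyadic n * Q w))%:E in E2.
  have me1 : measurable_fun setT e1 by exact/measurable_EFinP/measurable_expJ.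
  have me2 : measurable_fun setT e2.
    apply/measurable_EFinP; apply: measurableT_comp => //; apply: measurable_funB.
      by apply: measurableT_comp => //; exact: measurable_funM.
    exact: measurable_funM.
  have h1 : (0 <= (dyadic n)^-1%:E)%E by rewrite lee_fin invr_ge0 ltW.
  have : (\int[P]_w f n w + \int[P]_w ((dyadic n)^-1%:E * e2 w) =
      \int[P]_w ((dyadic n)^-1%:E * e1 w))%E.
    rewrite -ge0_integralD//; last 2 first.
    - by move=> w _; rewrite mule_ge0// lee_fin expR_ge0.
    - exact: measurable_funeM.
    apply: eq_integral => w _; rewrite /f /e1 /e2 -!EFinM -EFinD expRD; congr EFin.
    by rewrite /approx (mulrC (Q w)); field; rewrite gt_eqF.
  rewrite !ge0_integralZl//; last 2 first.
  - by move=> w _; rewrite lee_fin expR_ge0.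
  - by move=> w _; rewrite lee_fin expR_ge0.
  rewrite E1 E2 -!EFinM => h.
  have -> : ((Num.sqrt K)^-1 - (Num.sqrt (K + dyadic n * G))^-1) / dyadic n =
      (dyadic n)^-1 * (Num.sqrt K)^-1 - (dyadic n)^-1 * Num.sqrt (K + dyadic n * G)^-1.
    rewrite sqrtrV; last by rewrite addr_ge0 ?(ltW K0)// mulr_ge0// ltW.
    by rewrite mulrBl ![_ / dyadic n]mulrC.
  by rewrite EFinB -h addeK.
under eq_cvg do rewrite fE.
move=> h; apply: (cvg_unique _ h); first exact: ereal_hausdorff.
have s0 : 0 < Num.sqrt K by rewrite sqrtr_gt0.
have sn_gt0 n : 0 < Num.sqrt (K + dyadic n * G).
  by rewrite sqrtr_gt0 ltr_wpDr// mulr_ge0// ltW.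
have sn_cvg : Num.sqrt (K + dyadic n * G) @[n --> \oo] --> Num.sqrt K.
  apply: continuous_cvg; first exact: sqrt_continuous.
  rewrite -[X in _ --> X]addr0 -[X in _ + X](mul0r G).
  by apply: cvgD; [exact: cvg_cst|apply: cvgM => //; exact: cvg_cst].
suff lim : (((Num.sqrt K)^-1 - (Num.sqrt (K + dyadic n * G))^-1) / dyadic n)
    @[n --> \oo] --> G / 2 * (Num.sqrt K ^+ 3)^-1.
  by apply: cvg_EFin => //; exact: nearW.
rewrite (_ : (fun n => _) = (fun n => G / (Num.sqrt K *
    Num.sqrt (K + dyadic n * G) * (Num.sqrt K + Num.sqrt (K + dyadic n * G)))));
  last first.
  apply/funext => n; have h0 := dyadic_gt0 n.
  have GE : G = (Num.sqrt (K + dyadic n * G) ^+ 2 - Num.sqrt K ^+ 2) / dyadic n.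
    have Kn : 0 <= K + dyadic n * G by rewrite addr_ge0 ?(ltW K0)// mulr_ge0// ltW.
    by rewrite (sqr_sqrtr Kn) (sqr_sqrtr (ltW K0)); field; rewrite gt_eqF.
  move: GE (sn_gt0 n) s0 h0.
  move: (dyadic n) (Num.sqrt K) (Num.sqrt (K + dyadic n * G)) => k s s'.
  by move=> -> s'0 s0 k0; field; rewrite !gt_eqF// addr_gt0.
rewrite (_ : _ * _ = G / (Num.sqrt K * Num.sqrt K * (Num.sqrt K + Num.sqrt K))).
  apply: cvgM; first exact: cvg_cst.
  apply: cvgV; first by rewrite gt_eqF// !mulr_gt0// addr_gt0.
  apply: cvgM; last by apply: cvgD => //; exact: cvg_cst.
  by apply: cvgM => //; exact: cvg_cst.
by move: s0; move: (Num.sqrt K) => s s0; field; rewrite !gt_eqF// addr_gt0.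
Qed.

End moments.

Section inverse_moments.
Context {d : measure_display} {Om : measurableType d} {R : realType}
  (P : probability Om R).
Variables (a T : R) (a0 : 0 <= a) (T0 : 0 < T) (T1 : T < 1).
Variables (W X : R -> {RV P >-> R}).
Hypotheses (W_bm : brownian_motion01 W) (X_bridge : alpha_brownian_bridge a W X).
Local Notation L := (log_horizon T).
Local Notation th := (1 / 2 - a).
Local Notation J := (bridge_energy T X).
Local Notation Q := (bridge_terminal T X).
Local Notation mu := (@lebesgue_measure R).
Local Notation rate := (energy_rate a).

Let mJ : measurable_fun setT J := measurable_bridge_energy T X.

Let L0 : 0 < L := log_horizon_gt0 T0 T1.

(** The probability that J <= 0 is at most the Laplace transform of J at every
    point, and the transform vanishes at infinity since [denom] does not stay
    bounded. *)
Lemma bridge_energy_gt0 : {ae P, forall w, 0 < J w}.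
Proof.
have mB : measurable [set w | J w <= 0].
  rewrite (_ : [set w | J w <= 0] = J @^-1` `]-oo, 0]); last first.
    by apply/seteqP; split => w /=; rewrite in_itv.
  by rewrite -[X in measurable X]setTI; apply: mJ.
exists [set w | J w <= 0]; split => //; last by move=> w /= /negP; rewrite -leNgt.
apply/eqP; rewrite eq_le measure_ge0 andbT; apply/lee_addgt0Pr => e e0.
rewrite add0e.
(* u is large enough for the transform at [energy_rate a u] to be at most e *)
pose c := expR (th * L) * denom_bound a T / 2.
have c0 : 0 < c by rewrite divr_gt0// mulr_gt0 ?expR_gt0// denom_bound_gt0.
pose u := `|th| + 1 + (e ^+ 2 * c * L)^-1.
have u1 : 1 <= u.
  rewrite /u -addrA addrCA lerDl addr_ge0// invr_ge0 !mulr_ge0 ?sqr_ge0// ltW//.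
have u0 : 0 < u by exact: lt_le_trans u1.
have thu : `|th| <= u.
  by rewrite /u -addrA lerDl addr_ge0// invr_ge0 !mulr_ge0 ?sqr_ge0// ltW.
have K_ge : (e^-1) ^+ 2 <= laplace_sol th u 0 L.
  have h1 := denom_ge T0 T1 (le_trans (ler_norm _) thu).
  rewrite laplace_sol_denom//.
  have h2 : u * L <= expR (`|u| * L).
    by rewrite gtr0_norm//; have := expR_ge1Dx (u * L); lra.
  have h3 : c * (u * L) <= expR (th * L) * denom a T u / 2.
    apply: le_trans (ler_wpM2l (ltW c0) h2) _.
    by rewrite /c mulrAC ler_pM2r// -mulrA ler_pM2l ?expR_gt0.
  apply: le_trans h3.
  have -> : (e^-1) ^+ 2 = c * ((e ^+ 2 * c * L)^-1 * L).
    by field; rewrite !gt_eqF.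
  by rewrite ler_pM2l// ler_pM2r// /u lerDr addr_ge0.
apply: (@le_trans _ _ (\int[P]_w (expR (- (rate u * J w)))%:E)%E).
  have -> : P [set w | J w <= 0] = (\int[P]_(w in [set w | (J w <= 0)%R]) (cst 1 w))%E.
    by rewrite integral_cst// mul1e.
  apply: (@le_trans _ _ (\int[P]_(w in [set w | (J w <= 0)%R]) (expR (- (rate u * J w)))%:E)%E).
    apply: ge0_le_integral => //.
    - apply/measurable_EFinP; apply: measurable_funTS.
      by apply: measurableT_comp => //; apply: measurableT_comp => //; exact: measurable_funM.
    - move=> w /= Jw; rewrite lee_fin -[leLHS]expR0 ler_expR oppr_ge0.
      apply: mulr_ge0_le0 => //; rewrite /energy_rate divr_ge0// subr_ge0.
      by rewrite -(real_normK (num_real th)) ler_sqr ?nnegrE// ltW.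
  apply: ge0_subset_integral => //.
    apply/measurable_EFinP.
    by apply: measurableT_comp => //; apply: measurableT_comp => //; exact: measurable_funM.
rewrite (laplace_energy a0 T0 T1 W_bm X_bridge thu u0) lee_fin.
rewrite -[leRHS]invrK lef_pV2 ?posrE ?invr_gt0 ?sqrtr_gt0//; last first.
  exact: laplace_sol_gt0 thu u0 (lexx 0) (ltW L0).
by rewrite -[leLHS](ger0_norm (ltW _)) ?invr_gt0// -sqrtr_sqr ler_wsqrtr.
Qed.

(** The integrand is the derivative in u of - exp (- rate u j) / j, and the rate
    vanishes at |th|: this is the reason for the parametrization by u. *)
Lemma integral_rate_tail j : 0 < j ->
  (\int[mu]_(u in `[`|th|%R, +oo[) (u * expR (- (rate u * j)))%:E = j^-1%:E)%E.
Proof.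
move=> j0.
have E : (\int[mu]_(u in `[`|th|%R, +oo[) (u * j * expR (- (rate u * j)))%:E = 1)%E.
  transitivity (expR (- (rate `|th| * j)))%:E; last first.
    by rewrite /energy_rate real_normK ?num_real// subrr !mul0r oppr0 expR0.
  apply: (@integral_expR_tail _ (fun u => rate u * j) (fun u => u * j)).
  - move=> u.
    have D := is_deriveM (is_deriveB (is_deriveX 2 (is_derive_id u (1 : R)))
      (is_derive_cst (th ^+ 2) u (1 : R))) (is_derive_cst (j / 2) u (1 : R)).
    rewrite (_ : (fun u => rate u * j) = (id ^+ 2 - cst (th ^+ 2)) * cst (j / 2)).
      by apply: is_derive_eq D _; rewrite scaler0 add0r subr0 /GRing.scale /=; field.
    by apply/funext => x; rewrite /energy_rate !fctE; field.
  - by move=> u; apply: cvgM; [exact: cvg_id|exact: cvg_cst].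
  - by move=> u tu; rewrite mulr_ge0 ?(ltW j0)// (le_trans _ tu).
  - apply: gt0_cvgMly => //; apply: gt0_cvgMly; first by rewrite invr_gt0.
    apply/cvgryPge => A; near=> u.
    have u1 : 1 <= u by near: u; apply: nbhs_pinfty_ge; rewrite num_real.
    have uA : A + th ^+ 2 <= u by near: u; apply: nbhs_pinfty_ge; rewrite num_real.
    nra.
transitivity (\int[mu]_(u in `[`|th|%R, +oo[) (j^-1%:E * (u * j * expR (- (rate u * j)))%:E))%E.
  by apply: eq_integral => u _; rewrite -EFinM; congr EFin; field; rewrite gt_eqF.
rewrite ge0_integralZl//.
- by rewrite E mule1.
- apply/measurable_EFinP; apply: measurable_funTS; apply: measurable_funM.
    exact: measurable_funM.
  apply: measurableT_comp => //; apply: measurableT_comp => //.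
  apply: measurable_funM => //; apply: measurable_funM => //.
  exact: measurable_funB.
- by move=> u; rewrite /= in_itv /= andbT => tu; rewrite lee_fin !mulr_ge0 ?expR_ge0 ?(ltW j0)// (le_trans _ tu).
- by rewrite lee_fin invr_ge0 ltW.
Unshelve. all: by end_near.
Qed.

(** [integral_rate_tail] at j = J, under the expectation, and Tonelli. *)
Lemma inverse_energy_moment (g : Om -> R) (Fg : R -> R) :
  measurable_fun setT g -> (forall w, 0 <= g w) ->
  (forall u, `|th| <= u -> 0 < u ->
    (\int[P]_w (g w * expR (- (rate u * J w)))%:E = (Fg u)%:E)%E) ->
  (\int[P]_w (g w / J w)%:E =
   \int[mu]_(u in `[`|th|%R, +oo[) (u * Fg u)%:E)%E.
Proof.
move=> mg g0 FgE; pose D : set R := `[`|th|, +oo[%classic.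
pose h (w : Om) (u : R) := u * (g w * expR (- (rate u * J w))).
have hD0 w u : D u -> 0 <= h w u.
  rewrite /D /= in_itv /= andbT => tu.
  by rewrite mulr_ge0 ?mulr_ge0 ?expR_ge0// (le_trans _ tu).
pose f (x : Om * measurableTypeR R) : \bar R := (\1_D x.2 * h x.1 x.2)%:E.
have mD : measurable (D : set (measurableTypeR R)) by exact: measurable_itv.
have fE w u : f (w, u) = ((fun u => (h w u)%:E) \_ D) u.
  by rewrite /f patchE indicE /=; case: ifP => _; rewrite ?mul1r ?mul0r.
have f0 x : (0 <= f x)%E.
  by case: x => w u; rewrite fE patchE; case: ifPn => // /set_mem uD; rewrite lee_fin hD0.
have mf : measurable_fun setT f.
  apply/measurable_EFinP; apply: measurable_funM.
    have mi : measurable_fun setT (\1_(D : set (measurableTypeR R)) : measurableTypeR R -> R).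
      by apply: measurable_indic; exact: mD.
    exact: (measurableT_comp mi measurable_snd).
  apply: measurable_funM => //; apply: measurable_funM.
    exact: measurableT_comp.
  apply: measurableT_comp => //; apply: measurableT_comp => //.
  apply: measurable_funM; last exact: measurableT_comp.
  apply: measurable_funM => //; apply: measurable_funB => //.
  exact: measurable_funX.
transitivity (\int[P]_w \int[mu]_u f (w, u))%E.
  have mI : measurable_fun setT (fun w => \int[mu]_u f (w, u))%E.
    exact: measurable_fun_fubini_tonelli_F.
  apply: ge0_ae_eq_integral => //.
  - apply/measurable_EFinP; apply: measurable_funM => //; exact: measurable_funV.
  - by move=> w _; rewrite lee_fin divr_ge0// bridge_energy_ge0.
  - by move=> w _; apply: integral_ge0.
  apply: filterS bridge_energy_gt0 => w Jw _.
  under eq_integral do rewrite fE.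
  rewrite -integral_mkcond.
  under eq_integral => u _ do rewrite /h mulrCA EFinM.
  rewrite ge0_integralZl//.
  - by rewrite integral_rate_tail// -EFinM.
  - apply/measurable_EFinP; apply: measurable_funTS; apply: measurable_funM => //.
    apply: measurableT_comp => //; apply: measurableT_comp => //.
    apply: measurable_funM => //; apply: measurable_funM => //.
    exact: measurable_funB.
  - by move=> u; rewrite /D /= in_itv /= andbT => tu; rewrite lee_fin mulr_ge0 ?expR_ge0// (le_trans _ tu).
  - by rewrite lee_fin.
transitivity (\int[mu]_u \int[P]_w f (w, u))%E; first exact: fubini_tonelli.
under eq_integral => u _.
  rewrite (_ : (\int[P]_w f (w, u))%E = ((fun u => (u * Fg u)%:E) \_ D) u).
    over.
  under eq_integral do rewrite fE patchE.
  rewrite patchE; case: ifPn => [/set_mem|_]; last by rewrite integral0.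
  rewrite /D /= in_itv /= andbT => tu.
  have [u0|u0] := ltP 0 u; last first.
    have -> : u = 0 by apply/eqP; rewrite eq_le u0 (le_trans _ tu).
    by under eq_integral do rewrite /h mul0r; rewrite integral0 mul0r.
  under eq_integral do rewrite /h EFinM.
  rewrite ge0_integralZl//.
  - by rewrite FgE// -EFinM.
  - apply/measurable_EFinP; apply: measurable_funM => //.
    by apply: measurableT_comp => //; apply: measurableT_comp => //; exact: measurable_funM.
  - by move=> w _; rewrite lee_fin mulr_ge0 ?expR_ge0.
  - by rewrite lee_fin ltW.
by rewrite -integral_mkcond.
Qed.

End inverse_moments.

(** * The mean of the estimator *)

Section estimator_mean.
Context {d : measure_display} {Om : measurableType d} {R : realType}
  (P : probability Om R).
Variables (a T : R) (a0 : 0 <= a) (T0 : 0 < T) (T1 : T < 1).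
Variables (W X : R -> {RV P >-> R}).
Hypotheses (W_bm : brownian_motion01 W) (X_bridge : alpha_brownian_bridge a W X).
Local Notation L := (log_horizon T).
Local Notation th := (1 / 2 - a).
Local Notation J := (bridge_energy T X).
Local Notation Q := (bridge_terminal T X).
Local Notation mu := (@lebesgue_measure R).

(** The constant relating u K ^ (- 1 / 2) to [integrand_energy], where
    K = exp (th L) * denom u / 2. *)
Definition laplace_factor : R := Num.sqrt 2 * expR (- (th * L / 2)).

Local Notation kap := laplace_factor.

Lemma inv_sqrt_laplace_sol u : th <= u ->
  (Num.sqrt (laplace_sol th u 0 L))^-1 = kap / Num.sqrt (denom a T u).
Proof.
move=> thu; rewrite laplace_sol_denom// mulrAC.
rewrite sqrtrM ?divr_ge0 ?expR_ge0// invfM; congr (_ / _).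
have e0 : 0 <= expR (th * L / 2) by exact: expR_ge0.
have -> : expR (th * L) = expR (th * L / 2) ^+ 2.
  by rewrite -expRM_natl; congr expR; field.
rewrite sqrtrM ?sqr_ge0// sqrtr_sqr ger0_norm// invfM mulrC /laplace_factor.
by rewrite expRN sqrtrV// invrK.
Qed.

Lemma laplace_energy_tail u : `|th| <= u ->
  u * (Num.sqrt (laplace_sol th u 0 L))^-1 = kap * integrand_energy a T u.
Proof.
move=> thu; rewrite (inv_sqrt_laplace_sol (le_trans (ler_norm _) thu)).
by rewrite /integrand_energy mulrCA.
Qed.

(** The factor u cancels the one in the slope. At u = 0, which the range
    contains when th = 0, both sides vanish. *)
Lemma laplace_terminal_tail u : `|th| <= u ->
  u * (laplace_slope a T u / 2 * (Num.sqrt (laplace_sol th u 0 L) ^+ 3)^-1) =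
  - kap * integrand_terminal a T u.
Proof.
move=> thu; have thu' := le_trans (ler_norm _) thu.
have d0 := denom_gt0 T0 T1 thu'.
rewrite -exprVn (inv_sqrt_laplace_sol thu') /integrand_terminal powR32//.
have [->|u0] := eqVneq u 0.
  by rewrite oppr0 subrr !mul0r mulr0.
rewrite !powR_horizon// (mulNr u) opprK /laplace_slope.
have -> : expR ((u + th) * L) = expR (th * L / 2) ^+ 2 * expR (u * L).
  by rewrite -expRM_natl -expRD; congr expR; field.
have -> : expR ((th - u) * L) = expR (th * L / 2) ^+ 2 * expR (- (u * L)).
  by rewrite -expRM_natl -expRD; congr expR; field.
have s0 : Num.sqrt (denom a T u) != 0 by rewrite gt_eqF// sqrtr_gt0.
have k2 : kap ^+ 2 = 2 / expR (th * L / 2) ^+ 2.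
  by rewrite /laplace_factor exprMn sqr_sqrtr// expRN exprVn.
rewrite expr_div_n (exprS kap 2) k2.
have e0 : expR (th * L / 2) != 0 by rewrite gt_eqF// expR_gt0.
move: s0 e0; move: (Num.sqrt _) (expR (th * L / 2)) (expR (u * L)) (expR _) kap.
by move=> s e e1 e2 k s0 e0; field; rewrite u0 s0 e0.
Qed.

Lemma expectation_inv_energy :
  (\int[P]_w (J w)^-1%:E =
   (kap * \int[mu]_(u in `[th, +oo[) integrand_energy a T u)%:E)%E.
Proof.
have thn : th <= `|th| := ler_norm _.
have iE := @integrable_integrand_energy R a T T0 T1.
under eq_integral do rewrite -[(J _)^-1]mul1r.
rewrite (@inverse_energy_moment _ _ _ P a T a0 T0 T1 W X W_bm X_bridge (cst 1)
  (fun u => (Num.sqrt (laplace_sol th u 0 L))^-1))//; last first.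
  move=> u thu u0; under eq_integral do rewrite mul1r.
  exact: (laplace_energy a0 T0 T1 W_bm X_bridge thu u0).
rewrite (Rintegral_odd_tail (iE _ (lexx th)))//; last 2 first.
- exact: measurable_integrand_energy.
- exact: integrand_energyN.
rewrite EFinM fineK; last exact: integrable_fin_num (iE _ thn).
rewrite -integralZl//; last exact: iE.
apply: eq_integral => u; rewrite inE /= in_itv /= andbT => tu.
by rewrite laplace_energy_tail.
Qed.

Lemma expectation_terminal_energy :
  (\int[P]_w (Q w / J w)%:E =
   (- kap * \int[mu]_(u in `[th, +oo[) integrand_terminal a T u)%:E)%E.
Proof.
have thn : th <= `|th| := ler_norm _.
have iE := @integrable_integrand_terminal R a T T0 T1.
rewrite (@inverse_energy_moment _ _ _ P a T a0 T0 T1 W X W_bm X_bridge Q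
  (fun u => laplace_slope a T u / 2 * (Num.sqrt (laplace_sol th u 0 L) ^+ 3)^-1))//; last 3 first.
- exact: measurable_bridge_terminal.
- by move=> w; exact: bridge_terminal_ge0.
- by move=> u thu u0; exact: (laplace_terminal a0 T0 T1 W_bm X_bridge thu u0).
rewrite (Rintegral_odd_tail (iE _ (lexx th)))//; last 2 first.
- exact: measurable_integrand_terminal.
- exact: integrand_terminalN.
rewrite EFinM fineK; last exact: integrable_fin_num (iE _ thn).
rewrite -integralZl//; last exact: iE.
apply: eq_integral => u; rewrite inE /= in_itv /= andbT => tu.
by rewrite laplace_terminal_tail.
Qed.

(** By [ito_integral_bridge], and because the energy is almost surely
    positive. *)
Lemma alpha_mleE (ahat : {RV P >-> R}) : alpha_mle T X ahat ->
  {ae P, forall w, ahat w = 1 / 2 + L / 2 * (J w)^-1 - 1 / 2 * (Q w / J w)}.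
Proof.
move=> [I I_ito]; have I_E := ito_integral_bridge a0 T0 T1 W_bm X_bridge I_ito.
have J_E := bridge_energyE T0 T1 X_bridge.
have J_gt0 := bridge_energy_gt0 a0 T0 T1 W_bm X_bridge.
apply: filterS3 (filterI I_E J_E) J_gt0 => w [IE JE] Jw ->.
transitivity (- I w / J w); first by rewrite JE.
have -> : - I w = (J w + L - Q w) / 2 by lra.
by move: Jw; move: (J w) (Q w) L => j q l j0; field; rewrite gt_eqF.
Qed.

Lemma expectation_alpha_mle (ahat : {RV P >-> R}) : alpha_mle T X ahat ->
  'E_P[ahat]%E =
  (1 / 2
   + L / 2 * (kap * \int[mu]_(u in `[th, +oo[) integrand_energy a T u)
   + 1 / 2 * (kap * \int[mu]_(u in `[th, +oo[) integrand_terminal a T u))%:E.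
Proof.
move=> /alpha_mleE ahatE; rewrite expectation_def.
have mJ : measurable_fun setT (fun w => (J w)^-1).
  by apply: measurable_funV; exact: measurable_bridge_energy.
have mQ := measurable_bridge_terminal T X.
have iJ : P.-integrable setT (fun w => (J w)^-1%:E).
  apply/integrableP; split; first exact/measurable_EFinP.
  under eq_integral => w _ do rewrite gee0_abs ?lee_fin ?invr_ge0 ?bridge_energy_ge0//.
  by rewrite expectation_inv_energy ltry.
have iQ : P.-integrable setT (fun w => (Q w / J w)%:E).
  apply/integrableP; split; first by apply/measurable_EFinP; exact: measurable_funM.
  under eq_integral => w _.
    rewrite gee0_abs; last first.
      by rewrite lee_fin divr_ge0 ?bridge_energy_ge0 ?(bridge_terminal_ge0 T1).
    over.
  by rewrite expectation_terminal_energy ltry.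
pose F w : \bar R := ((1 / 2)%:E + (L / 2)%:E * (J w)^-1%:E + (- (1 / 2))%:E * (Q w / J w)%:E)%E.
have iJ' : P.-integrable setT (fun w => (L / 2)%:E * (J w)^-1%:E)%E.
  exact: integrableZl.
have iQ' : P.-integrable setT (fun w => (- (1 / 2))%:E * (Q w / J w)%:E)%E.
  exact: integrableZl.
have i1 : P.-integrable setT (fun=> (1 / 2)%:E).
  exact: finite_measure_integrable_cst.
have iD : P.-integrable setT (fun w => (1 / 2)%:E + (L / 2)%:E * (J w)^-1%:E)%E.
  exact: integrableD.
transitivity (\int[P]_w F w)%E.
  apply: ae_eq_integral => //.
  - exact/measurable_EFinP.
  - by case/integrableP: (integrableD measurableT iD iQ').
  - apply: filterS ahatE => w -> _.
    by rewrite /F -!EFinM -!EFinD (mulNr (1 / 2)).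
rewrite integralD// integralD// !integralZl// expectation_inv_energy.
rewrite expectation_terminal_energy integral_cst// [X in (_ * X)%E]probability_setT mule1.
by rewrite -!EFinM -!EFinD (mulNr kap) mulrNN.
Qed.

End estimator_mean.

Theorem proposition1 (d : measure_display) (Om : measurableType d)
    (R : realType) (P : probability Om R) (alpha T : R)
    (W X : R -> {RV P >-> R}) (ahat : {RV P >-> R})
    (alpha_ge0 : 0 <= alpha) (T_gt0 : 0 < T) (T_lt1 : T < 1)
    (W_bm : brownian_motion01 W)
    (X_bridge : alpha_brownian_bridge alpha W X)
    (ahat_mle : alpha_mle T X ahat) :
  'E_P[ahat]%E =
  (1 / 2
   + (1 - T) `^ ((1 - 2 * alpha) / 4) / Num.sqrt 2
     * \int[lebesgue_measure]_(u in `[(1 - 2 * alpha) / 2, +oo[)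
         (((1 - T) `^ u - (1 - T) `^ (- u))
          / ((1 + (1 - 2 * alpha) / (2 * u)) * (1 - T) `^ u
             + (1 - (1 - 2 * alpha) / (2 * u)) * (1 - T) `^ (- u))
            `^ (3 / 2))
   - ln (1 - T) * (1 - T) `^ ((1 - 2 * alpha) / 4) / Num.sqrt 2
     * \int[lebesgue_measure]_(u in `[(1 - 2 * alpha) / 2, +oo[)
         (u
          / Num.sqrt
              ((1 + (1 - 2 * alpha) / (2 * u)) * (1 - T) `^ u
               + (1 - (1 - 2 * alpha) / (2 * u)) * (1 - T) `^ (- u))))%:E.
Proof.
rewrite (expectation_alpha_mle alpha_ge0 T_gt0 T_lt1 W_bm X_bridge ahat_mle).
have -> : (1 - 2 * alpha) / 2 = 1 / 2 - alpha by field.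
have factorE : (1 - T) `^ ((1 - 2 * alpha) / 4) / Num.sqrt 2 =
    laplace_factor alpha T / 2.
  rewrite powR_horizon// /laplace_factor.
  have -> : (1 - 2 * alpha) / 4 * log_horizon T =
      (1 / 2 - alpha) * log_horizon T / 2.
    by move: (log_horizon T) => l; field.
  have s2 : Num.sqrt 2 != 0 :> R by rewrite gt_eqF// sqrtr_gt0.
  have q2 : Num.sqrt 2 ^+ 2 = 2 :> R by rewrite sqr_sqrtr.
  move: s2 q2; move: (Num.sqrt 2) (expR _) => s e s2 <-; field.
  exact: s2.
rewrite -[_ * _ / Num.sqrt 2]mulrA factorE /log_horizon.
pose It := \int[lebesgue_measure]_(u in `[1 / 2 - alpha, +oo[)
  integrand_terminal alpha T u.
pose Ie := \int[lebesgue_measure]_(u in `[1 / 2 - alpha, +oo[)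
  integrand_energy alpha T u.
rewrite -/It -/Ie; congr EFin.
by move: It Ie (ln _) (laplace_factor _ _) => it ie l k; field.
Qed.
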